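(* Let $(U,A)$ be a left bialgebroid and let $R$ be a braided commutative Yetter-Drinfeld algebra in ${}_U\mathbf{YD}^U$ (i.e. a braided commutative monoid in the category of left-right Yetter-Drinfeld modules over $U$). Then the smash product $R\#U$ (with its structure maps as given in the context) is a left bialgebroid over $R$; and $R\#U$ is a right Hopf algebroid if $(U,A)$ is a right Hopf algebroid.
   Context: Let $k$ be a commutative ring; algebras are unital associative $k$-algebras. LEFT BIALGEBROIDS. A left bialgebroid $(U,A,s,t,\Delta,\varepsilon)$ over the algebra $A$ consists of an algebra $U$, algebra maps $s:A\to U$ (source) and $t:A^{op}\to U$ (target) with commuting images, and maps $\Delta,\varepsilon$ as follows. Write $a\triangleright u\triangleleft b:=s(a)t(b)u$ and $a\blacktriangleright u\blacktriangleleft b:=u\,t(a)s(b)$; triangles as subscripts indicate the module structure used. $\Delta:U\to U_\triangleleft\otimes_A{}_\triangleright U$, $u\mapsto u_{(1)}\otimes_A u_{(2)}$ (so $t(a)u\otimes_A u'=u\otimes_A s(a)u'$) and $\varepsilon:U\to A$ make ${}_\triangleright U_\triangleleft$ an $A$-coring; $\Delta$ takes values in the Takeuchi subspace of elements $\sum_i u_i\otimes_A u_i'$ with $\sum_i u_it(a)\otimes_A u'_i=\sum_i u_i\otimes_A u_i's(a)$ for all $a$, and is a unital algebra map into it; $\varepsilon(1)=1$ and $\varepsilon(uu')=\varepsilon(u\,s(\varepsilon(u')))=\varepsilon(u\,t(\varepsilon(u')))$. Each left $U$-module $M$ is an $A$-bimodule via $a\triangleright m\triangleleft b:=s(a)t(b)m$.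 A left bialgebroid $(U,A)$ is a right Hopf algebroid if the map $\alpha_r:U_\blacktriangleleft\otimes_A{}_\triangleright U\to U_\triangleleft\otimes_A{}_\triangleright U$, $u\otimes_A u'\mapsto u_{(1)}u'\otimes_A u_{(2)}$, is bijective. A right $U$-comodule is a right $A$-module $M$ with a right $A$-linear coassociative counital coaction $\rho_M:M\to M\otimes_A{}_\triangleright U$, $m\mapsto m_{[0]}\otimes_A m_{[1]}$; with the induced left action $am:=m_{[0]}\varepsilon(m_{[1]}s(a))$ one has $\rho_M(ama')=m_{[0]}\otimes_A t(a')m_{[1]}t(a)$ and $am_{[0]}\otimes_A m_{[1]}=m_{[0]}\otimes_A m_{[1]}s(a)$. ${}_U\mathbf{YD}^U$: objects are left $U$-modules and right $U$-comodules $M$ for which the two $A$-bimodule structures coincide and $u_{(1)}m_{[0]}\otimes_A u_{(2)}m_{[1]}=(u_{(2)}m)_{[0]}\otimes_A(u_{(2)}m)_{[1]}u_{(1)}$. A monoid in ${}_U\mathbf{YD}^U$ is an object $R$ that is a unital algebra $(R,\cdot)$ with: $u(r\cdot r')=(u_{(1)}r)\cdot(u_{(2)}r')$, $u1_R=\varepsilon(u)\triangleright 1_R$; $a(r\cdot r')=(ar)\cdot r'$, $(r\cdot r')a=r\cdot(r'a)$, $(ra)\cdot r'=r\cdot(ar')$; $(r\cdot r')_{[0]}\otimes_A(r\cdot r')_{[1]}=r_{[0]}\cdot r'_{[0]}\otimes_A r'_{[1]}r_{[1]}$, $1_{[0]}\otimes_A1_{[1]}=1_R\otimes_A1_U$.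 It is braided commutative if $r\cdot r'=r'_{[0]}\cdot(r'_{[1]}r)$ for all $r,r'$. SMASH PRODUCT. For $R$ a braided commutative monoid in ${}_U\mathbf{YD}^U$, $R\#U$ denotes $R\otimes_A{}_\triangleright U$ with product $(r\otimes_A u)(r'\otimes_A u')=r\cdot(u_{(1)}r')\otimes_A u_{(2)}u'$, source $r\mapsto r\otimes_A1$, target $r\mapsto r_{[0]}\otimes_A r_{[1]}$, coproduct $r\otimes_A u\mapsto(r\otimes_A u_{(1)})\otimes_R(1\otimes_A u_{(2)})$ and counit $r\otimes_A u\mapsto r\varepsilon(u)$. *)

(* Defs.v *)
From HB Require Import structures.
From mathcomp Require Import all_boot all_algebra boolp.

Set Implicit Arguments.
Unset Strict Implicit.
Unset Printing Implicit Defensive.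

Import GRing.Theory.
Local Open Scope ring_scope.
Local Open Scope quotient_scope.

(* Unital associative k-algebras.  MathComp's algType would do, except that it
   requires 1 != 0; here the zero algebra is allowed.  The two-step definition
   allows an algebra structure to be put on a given k-module. *)
Record alg_on (k : pzRingType) (V : lmodType k) := AlgOn {
  alg_one : V;
  alg_mul : V -> V -> V;
  alg_mulA : associative alg_mul;
  alg_mul1x : left_id alg_one alg_mul;
  alg_mulx1 : right_id alg_one alg_mul;
  alg_mulDl : left_distributive alg_mul +%R;
  alg_mulDr : right_distributive alg_mul +%R;
  alg_scaleAl : forall (c : k) x y, c *: alg_mul x y = alg_mul (c *: x) y;
  alg_scaleAr : forall (c : k) x y, c *: alg_mul x y = alg_mul x (c *: y)
}.

Record pzAlgType (k : pzRingType) := PzAlg {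
  pzalg_mod : lmodType k;
  pzalg_on : alg_on pzalg_mod
}.

Definition pzalg_sort (k : pzRingType) (S : pzAlgType k) : Type := pzalg_mod S.
Coercion pzalg_sort : pzAlgType >-> Sortclass.

Section PzAlgTheory.
Variables (k : pzRingType) (S : pzAlgType k).
HB.instance Definition _ := GRing.Lmodule.copy (pzalg_sort S) (pzalg_mod S).
HB.instance Definition _ := GRing.Zmodule_isPzRing.Build (pzalg_sort S)
  (alg_mulA (pzalg_on S)) (alg_mul1x (pzalg_on S)) (alg_mulx1 (pzalg_on S))
  (alg_mulDl (pzalg_on S)) (alg_mulDr (pzalg_on S)).

Lemma pzscalerAl (c : k) (x y : S) : c *: (x * y) = (c *: x) * y.
Proof. exact: (alg_scaleAl (pzalg_on S)). Qed.

Lemma pzscalerAr (c : k) (x y : S) : c *: (x * y) = x * (c *: y).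
Proof. exact: (alg_scaleAr (pzalg_on S)). Qed.
End PzAlgTheory.

(* Tensor product of k-modules M and N balanced over the set of operators A,
   acting on M on the right by ra and on N on the left by la.  The actions are
   plain functions, so that the same carrier may be used with several of them.
   A formal sum of pairs (m, n) is a sequence; teq is the smallest k-linear
   congruence making (m, n) bilinear and balanced. *)
Section Tensor.
Variables (k : comPzRingType) (M N : lmodType k) (A : Type).
Variables (ra : M -> A -> M) (la : A -> N -> N).

Implicit Types s : seq (M * N).

Definition tscale (c : k) s := [seq (c *: p.1, p.2) | p <- s].

Inductive teq : seq (M * N) -> seq (M * N) -> Prop :=
| teq_refl s : teq s s
| teq_sym s1 s2 : teq s1 s2 -> teq s2 s1
| teq_trans s1 s2 s3 : teq s1 s2 -> teq s2 s3 -> teq s1 s3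
| teq_cat s1 s2 s3 s4 : teq s1 s2 -> teq s3 s4 -> teq (s1 ++ s3) (s2 ++ s4)
| teq_scale c s1 s2 : teq s1 s2 -> teq (tscale c s1) (tscale c s2)
| teq_catC s1 s2 : teq (s1 ++ s2) (s2 ++ s1)
| teq_0l n : teq [:: (0, n)] [::]
| teq_Dl m m' n : teq [:: (m + m', n)] [:: (m, n); (m', n)]
| teq_Dr m n n' : teq [:: (m, n + n')] [:: (m, n); (m, n')]
| teq_Z c m n : teq [:: (c *: m, n)] [:: (m, c *: n)]
| teq_bal m a n : teq [:: (ra m a, n)] [:: (m, la a n)].

Definition teqb s1 s2 : bool := `[< teq s1 s2 >].

Lemma teqb_equiv : equiv_class_of teqb.
Proof.
split=> [s | s1 s2 | s2 s1 s3].
- exact/asboolP/teq_refl.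
- by apply/asboolP/asboolP => /teq_sym.
- by move=> /asboolP h /asboolP h'; apply/asboolP/(teq_trans h).
Qed.

Canonical teqb_equivRel := EquivRelPack teqb_equiv.

Definition tensor := {eq_quot teqb}.
HB.instance Definition _ := Choice.on tensor.
HB.instance Definition _ := EqQuotient.on tensor.

Definition tens (m : M) (n : N) : tensor := \pi_tensor [:: (m, n)].

Lemma tensor_eqP s1 s2 : \pi_tensor s1 = \pi_tensor s2 <-> teq s1 s2.
Proof.
split=> [/eqP h | h]; last by apply/eqP; rewrite eqmodE; apply/asboolP.
by move: h; rewrite eqmodE => /asboolP.
Qed.

Lemma teq_repr s : teq (repr (\pi_tensor s)) s.
Proof. by apply/tensor_eqP; rewrite reprK. Qed.

Definition tzero : tensor := \pi_tensor [::].
Definition tadd (x y : tensor) : tensor := \pi_tensor (repr x ++ repr y).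
Definition tZ (c : k) (x : tensor) : tensor := \pi_tensor (tscale c (repr x)).
Definition topp (x : tensor) : tensor := tZ (-1) x.

Lemma taddE s1 s2 : tadd (\pi_tensor s1) (\pi_tensor s2) = \pi_tensor (s1 ++ s2).
Proof. by apply/tensor_eqP/teq_cat; apply: teq_repr. Qed.

Lemma tZE c s : tZ c (\pi_tensor s) = \pi_tensor (tscale c s).
Proof. by apply/tensor_eqP/teq_scale/teq_repr. Qed.

Lemma taddA : associative tadd.
Proof.
move=> x y z; elim/quotW: x => x; elim/quotW: y => y; elim/quotW: z => z.
by rewrite (taddE y z) (taddE x y) !taddE catA.
Qed.

Lemma taddC : commutative tadd.
Proof.
move=> x y; elim/quotW: x => x; elim/quotW: y => y.
rewrite !taddE; exact/tensor_eqP/teq_catC.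
Qed.

Lemma tadd0 : left_id tzero tadd.
Proof. by move=> x; elim/quotW: x => x; rewrite taddE. Qed.

Lemma tscaleDl s c d : teq (tscale (c + d) s) (tscale c s ++ tscale d s).
Proof.
elim: s => [|[m n] s IH] /=; first exact: teq_refl.
have h := teq_cat (teq_Dl (c *: m) (d *: m) n) IH.
rewrite scalerDl; apply: teq_trans h _.
apply: (@teq_cat [:: (c *: m, n)] [:: (c *: m, n)]); first exact: teq_refl.
apply: (@teq_trans _ ((tscale c s ++ tscale d s) ++ [:: (d *: m, n)])).
  exact: (teq_catC [:: (d *: m, n)]).
by rewrite -catA; apply: teq_cat; [exact: teq_refl | exact: teq_catC].
Qed.

Lemma tscale0 s : teq (tscale 0 s) [::].
Proof.
elim: s => [|[m n] s IH] /=; first exact: teq_refl.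
rewrite scale0r; exact: (teq_cat (teq_0l n) IH).
Qed.

Lemma tZ1 : left_id 1 tZ.
Proof.
move=> x; elim/quotW: x => s; rewrite tZE; congr (\pi_tensor _).
by rewrite /tscale -[RHS]map_id; apply: eq_map => -[m n] /=; rewrite scale1r.
Qed.

Lemma taddN : left_inverse tzero topp tadd.
Proof.
move=> x; elim/quotW: x => s; rewrite /topp -{2}[\pi_tensor s]tZ1 !tZE taddE; apply/tensor_eqP.
apply: teq_trans (teq_sym (tscaleDl _ _ _)) _.
by rewrite addNr; apply: tscale0.
Qed.

HB.instance Definition _ := GRing.isZmodule.Build tensor taddA taddC tadd0 taddN.

Lemma tZA a b x : tZ a (tZ b x) = tZ (a * b) x.
Proof.
elim/quotW: x => s; rewrite (tZE b) !tZE; congr (\pi_tensor _).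
by rewrite /tscale -map_comp; apply: eq_map => -[m n] /=; rewrite scalerA.
Qed.

Lemma tZDr : right_distributive tZ +%R.
Proof.
move=> c x y; elim/quotW: x => x; elim/quotW: y => y.
by rewrite [\pi_tensor x + _]taddE !tZE [_ + _]taddE /tscale map_cat.
Qed.

Lemma tZDl x : {morph tZ^~ x : a b / a + b}.
Proof.
move=> a b; elim/quotW: x => s; rewrite !tZE [RHS]taddE.
exact/tensor_eqP/tscaleDl.
Qed.

HB.instance Definition _ :=
  GRing.Zmodule_isLmodule.Build k tensor tZA tZ1 tZDr tZDl.

(* Sum of f m n over a decomposition of x into pure tensors: this is the map
   induced by f as soon as f is bilinear and balanced, see tensor_sum_tens. *)
Definition tensor_sum (G : zmodType) (x : tensor) (f : M -> N -> G) : G :=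
  \sum_(p <- repr x) f p.1 p.2.

Record balanced (G : lmodType k) (f : M -> N -> G) : Prop := Balanced {
  balanced_linl : forall n, linear (f^~ n);
  balanced_linr : forall m, linear (f m);
  balanced_act : forall m a n, f (ra m a) n = f m (la a n)
}.

Lemma tens_balanced : balanced tens.
Proof.
have tD s1 s2 : \pi_tensor s1 + \pi_tensor s2 = \pi_tensor (s1 ++ s2) by exact: taddE.
have tS c s : c *: \pi_tensor s = \pi_tensor (tscale c s) by exact: tZE.
split=> [n c m m' | m c n n' | m a n]; rewrite /tens ?tS ?tD.
- exact/tensor_eqP/teq_Dl.
- apply/tensor_eqP/(teq_trans (teq_Dr _ _ _)).
  rewrite -[X in teq X]cat1s; apply: (@teq_cat _ [:: (c *: m, n)] [:: (m, n')]).
    exact/teq_sym/teq_Z.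
  exact: teq_refl.
- exact/tensor_eqP/teq_bal.
Qed.

Section Balanced.
Variables (G : lmodType k) (f : M -> N -> G).
Hypothesis fB : balanced f.

Lemma balanced0l n : f 0 n = 0.
Proof.
by have := balanced_linl fB n (-1) 0 0; rewrite scaler0 addr0 scaleN1r addNr.
Qed.

Lemma balanced0r m : f m 0 = 0.
Proof.
by have := balanced_linr fB m (-1) 0 0; rewrite scaler0 addr0 scaleN1r addNr.
Qed.

Lemma balancedZl c m n : f (c *: m) n = c *: f m n.
Proof.
by have := balanced_linl fB n c m 0; rewrite balanced0l !addr0.
Qed.

Lemma balancedZr c m n : f m (c *: n) = c *: f m n.
Proof.
by have := balanced_linr fB m c n 0; rewrite balanced0r !addr0.
Qed.

Lemma balanced_teq s1 s2 : teq s1 s2 ->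
  \sum_(p <- s1) f p.1 p.2 = \sum_(p <- s2) f p.1 p.2.
Proof.
elim=> {s1 s2} //.
- by move=> s1 s2 s3 _ -> _ ->.
- by move=> s1 s2 s3 s4 _ h _ h'; rewrite !big_cat /= h h'.
- move=> c s1 s2 _ h; rewrite !big_map /=.
  by do 2![under eq_bigr do rewrite balancedZl; rewrite -scaler_sumr]; rewrite h.
- by move=> s1 s2; rewrite !big_cat /= addrC.
- by move=> n; rewrite big_seq1 big_nil balanced0l.
- move=> m m' n; rewrite !big_cons !big_nil /= !addr0.
  by have := balanced_linl fB n 1 m m'; rewrite !scale1r.
- move=> m n n'; rewrite !big_cons !big_nil /= !addr0.
  by have := balanced_linr fB m 1 n n'; rewrite !scale1r.
- by move=> c m n; rewrite !big_seq1 /= balancedZl balancedZr.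
- by move=> m a n; rewrite !big_seq1 /= (balanced_act fB).
Qed.

Lemma tensor_sum_pi s :
  tensor_sum (\pi_tensor s) f = \sum_(p <- s) f p.1 p.2.
Proof. exact/balanced_teq/teq_repr. Qed.

Lemma tensor_sum_tens m n : tensor_sum (tens m n) f = f m n.
Proof. by rewrite tensor_sum_pi big_seq1. Qed.

Lemma tensor_sum_linear : linear (fun x => tensor_sum x f).
Proof.
move=> c x y; elim/quotW: x => x; elim/quotW: y => y.
rewrite [c *: _]tZE [_ + \pi_tensor y]taddE !tensor_sum_pi big_cat big_map /=.
by under eq_bigr do rewrite balancedZl; rewrite -scaler_sumr.
Qed.
End Balanced.

Lemma tensor_sumE (x : tensor) : tensor_sum x tens = x.
Proof.
elim/quotW: x => s; rewrite (tensor_sum_pi tens_balanced).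
elim: s => [|[m n] s IH]; first by rewrite big_nil.
by rewrite big_cons IH [LHS]taddE.
Qed.

End Tensor.

(* Sweedler notation: \swd_(m, n <- x) E is E summed over x = sum of m (x) n. *)
Notation "\swd_ ( m , n <- x ) E" := (tensor_sum x (fun m n => E))
  (at level 41, E at level 41, x at level 50, m name, n name,
   format "'[' \swd_ ( m ,  n  <-  x ) '/  '  E ']'") : ring_scope.

(* Right action on the right-hand factor of a tensor product. *)
Definition tensor_ract (k : comPzRingType) (M N : lmodType k) (A : Type)
    (ra : M -> A -> M) (la : A -> N -> N) (ra' : N -> A -> N)
    (x : tensor ra la) (a : A) : tensor ra la :=
  \swd_(m, n <- x) tens ra la m (ra' n a).

Section Bialgebroid.
Variables (k : comPzRingType) (A U : pzAlgType k).

(* In each axiom below, nested sums are ordered so that every summed expression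
   is balanced by the other axioms; e.g. in comulM only the sum over comul u
   of u1 v1 (x) u2 v2 is balanced in (v1, v2), by the Takeuchi condition. *)
Record left_bialgebroid := LeftBialgebroid {
  src : A -> U;
  tgt : A -> U;
  src_linear : linear src;
  src1 : src 1 = 1;
  srcM : forall a b, src (a * b) = src a * src b;
  tgt_linear : linear tgt;
  tgt1 : tgt 1 = 1;
  tgtM : forall a b, tgt (a * b) = tgt b * tgt a;
  src_tgtC : forall a b, src a * tgt b = tgt b * src a;
  lact : A -> U -> U := fun a u => src a * u;
  ract : U -> A -> U := fun u a => tgt a * u;
  comul : U -> tensor ract lact;
  counit : U -> A;
  comul_linear : linear comul;
  comul_lact : forall a u, comul (lact a u) =
    \swd_(u1, u2 <- comul u) tens ract lact (lact a u1) u2;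
  comul_ract : forall u a, comul (ract u a) =
    \swd_(u1, u2 <- comul u) tens ract lact u1 (ract u2 a);
  counit_linear : linear counit;
  counit_lact : forall a u, counit (lact a u) = a * counit u;
  counit_ract : forall u a, counit (ract u a) = counit u * a;
  comulA : forall u,
    \swd_(u1, u2 <- comul u) \swd_(v1, v2 <- comul u1)
      tens (@tensor_ract k U U A ract lact ract) lact (tens ract lact v1 v2) u2
    = \swd_(u1, u2 <- comul u) \swd_(v1, v2 <- comul u2)
      tens (@tensor_ract k U U A ract lact ract) lact (tens ract lact u1 v1) v2;
  counitl : forall u, \swd_(u1, u2 <- comul u) lact (counit u1) u2 = u;
  counitr : forall u, \swd_(u1, u2 <- comul u) ract u1 (counit u2) = u;
  comul_takeuchi : forall u a,
    \swd_(u1, u2 <- comul u) tens ract lact (u1 * tgt a) u2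
    = \swd_(u1, u2 <- comul u) tens ract lact u1 (u2 * src a);
  comul1 : comul 1 = tens ract lact 1 1;
  comulM : forall u v, comul (u * v) =
    \swd_(v1, v2 <- comul v) \swd_(u1, u2 <- comul u)
      tens ract lact (u1 * v1) (u2 * v2);
  counit1 : counit 1 = 1;
  counitM_src : forall u v, counit (u * v) = counit (u * src (counit v));
  counitM_tgt : forall u v, counit (u * v) = counit (u * tgt (counit v))
}.

Variable B : left_bialgebroid.

Definition tensU (u v : U) : tensor (ract B) (lact B) :=
  tens (ract B) (lact B) u v.

(* The right A-action on U given by right multiplication with the source. *)
Definition black_ract (u : U) (a : A) : U := u * src B a.

Definition alpha_r (x : tensor black_ract (lact B)) : tensor (ract B) (lact B) :=
  \swd_(u, v <- x) \swd_(u1, u2 <- comul B u) tensU (u1 * v) u2.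

Definition right_hopf : Prop := bijective alpha_r.

Record right_comodule (M : lmodType k) := RightComodule {
  cract : M -> A -> M;
  cract_linl : forall a, linear (cract^~ a);
  cract_linr : forall m, linear (cract m);
  cract1 : forall m, cract m 1 = m;
  cractM : forall m a b, cract m (a * b) = cract (cract m a) b;
  coact : M -> tensor cract (lact B);
  coact_linear : linear coact;
  coact_cract : forall m a, coact (cract m a) =
    \swd_(m0, m1 <- coact m) tens cract (lact B) m0 (ract B m1 a);
  coactA : forall m,
    \swd_(m0, m1 <- coact m) \swd_(n0, n1 <- coact m0)
      tens (@tensor_ract k M U A cract (lact B) (ract B)) (lact B)
        (tens cract (lact B) n0 n1) m1
    = \swd_(m0, m1 <- coact m) \swd_(u1, u2 <- comul B m1)
      tens (@tensor_ract k M U A cract (lact B) (ract B)) (lact B)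
        (tens cract (lact B) m0 u1) u2;
  coact_counit : forall m,
    \swd_(m0, m1 <- coact m) cract m0 (counit B m1) = m
}.

(* The left A-action induced by a right coaction. *)
Definition clact (M : lmodType k) (C : right_comodule M) (a : A) (m : M) : M :=
  \swd_(m0, m1 <- coact C m) cract C m0 (counit B (m1 * src B a)).

Record left_module (M : lmodType k) := LeftModule {
  act : U -> M -> M;
  act_linl : forall m, linear (act^~ m);
  act_linr : forall u, linear (act u);
  act1 : forall m, act 1 m = m;
  actM : forall u v m, act (u * v) m = act u (act v m)
}.

Record yd_module (M : lmodType k) := YDModule {
  yd_mod :> left_module M;
  yd_comod :> right_comodule M;
  yd_lact : forall a m, clact yd_comod a m = act yd_mod (src B a) m;
  yd_ract : forall m a, cract yd_comod m a = act yd_mod (tgt B a) m;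
  yd_compat : forall u m,
    \swd_(m0, m1 <- coact yd_comod m) \swd_(u1, u2 <- comul B u)
      tens (cract yd_comod) (lact B) (act yd_mod u1 m0) (u2 * m1)
    = \swd_(u1, u2 <- comul B u)
      \swd_(n0, n1 <- coact yd_comod (act yd_mod u2 m))
        tens (cract yd_comod) (lact B) n0 (n1 * u1)
}.

Record yd_algebra (R : pzAlgType k) := YDAlgebra {
  yda :> yd_module R;
  yda_actM : forall u r r', act yda u (r * r') =
    \swd_(u1, u2 <- comul B u) (act yda u1 r * act yda u2 r');
  yda_act1 : forall u, act yda u 1 = act yda (src B (counit B u)) 1;
  yda_lactM : forall a r r', clact yda a (r * r') = clact yda a r * r';
  yda_ractM : forall a r r', cract yda (r * r') a = r * cract yda r' a;
  yda_bal : forall a r r', cract yda r a * r' = r * clact yda a r';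
  yda_coactM : forall r r', coact yda (r * r') =
    \swd_(r0, r1 <- coact yda r) \swd_(r0', r1' <- coact yda r')
      tens (cract yda) (lact B) (r0 * r0') (r1' * r1);
  yda_coact1 : coact yda 1 = tens (cract yda) (lact B) 1 1
}.

Definition braided_commutative (R : pzAlgType k) (Y : yd_algebra R) : Prop :=
  forall r r' : R,
    r * r' = \swd_(r0', r1' <- coact Y r') (r0' * act Y r1' r).

(* The k-module underlying the smash product R # U. *)
Definition smash (R : pzAlgType k) (Y : yd_algebra R) : lmodType k :=
  tensor (cract Y) (lact B).

End Bialgebroid.

Section Smash.
Variables (k : comPzRingType) (A U : pzAlgType k) (B : left_bialgebroid A U).
Variables (R : pzAlgType k) (Y : yd_algebra B R).

Definition tensS (m : alg_on (smash Y)) (r : R) (u : U) : PzAlg m :=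
  tens (cract Y) (lact B) r u.

(* All maps below are additive, so these formulas determine them. *)
Record is_smash_product (m : alg_on (smash Y))
    (S : left_bialgebroid R (PzAlg m)) : Prop := IsSmashProduct {
  smash_mul : forall r u r' u', tensS m r u * tensS m r' u' =
    \swd_(u1, u2 <- comul B u) tensS m (r * act Y u1 r') (u2 * u');
  smash_src : forall r, src S r = tensS m r 1;
  smash_tgt : forall r, tgt S r = \swd_(r0, r1 <- coact Y r) tensS m r0 r1;
  smash_comul : forall r u, comul S (tensS m r u) =
    \swd_(u1, u2 <- comul B u) tensU S (tensS m r u1) (tensS m 1 u2);
  smash_counit : forall r u, counit S (tensS m r u) = cract Y r (counit B u)
}.
End Smash.

(* Main.v *)
Require Import Defs.
From mathcomp Require Import all_boot all_algebra.

(** In [R # U], braided commutativity gives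
      [t r' * (r (x) u) = r r'_0 (x) r'_1 u],
    so left multiplication by the target map only involves the coaction.  As
    [r (x) u = s r * (1 (x) u)] and [u |-> 1 (x) u] is multiplicative, every
    element of the target [H (x)_R H] of [alpha_r], for [H = R # U], is a sum
    of [(r (x) u) (x) (1 (x) v)], and similarly for its source.  On such
    elements the coring axioms reduce to those of [U], the Takeuchi condition
    becomes coassociativity followed by the Yetter-Drinfeld condition, and
    [alpha_r] of [R # U] becomes [R (x)_A alpha_r] of [U], which is bijective
    because [alpha_r] of [U] is bijective and left [A]-linear. *)

Set Implicit Arguments.
Unset Strict Implicit.
Unset Printing Implicit Defensive.

Import GRing.Theory.
Local Open Scope ring_scope.

(** * Linear maps and Sweedler sums *)

Section Linear.
Variables (k : comPzRingType) (V W : lmodType k).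

Lemma linear_idfun : linear (fun x : V => x).
Proof. by []. Qed.

Lemma linear_compfun (X : lmodType k) (h : W -> X) (g : V -> W) :
  linear h -> linear g -> linear (fun x => h (g x)).
Proof. by move=> hL gL c x y; rewrite gL hL. Qed.

Lemma linear_fun0 (h : V -> W) : linear h -> h 0 = 0.
Proof. by move=> hL; have := hL (-1) 0 0; rewrite scaler0 addr0 scaleN1r addNr. Qed.

Lemma linear_funD (h : V -> W) : linear h -> {morph h : x y / x + y}.
Proof. by move=> hL x y; have := hL 1 x y; rewrite !scale1r. Qed.

Lemma linear_funZ (h : V -> W) c x : linear h -> h (c *: x) = c *: h x.
Proof. by move=> hL; have := hL c x 0; rewrite (linear_fun0 hL) !addr0. Qed.

Lemma linear_mulr_fun (S : pzAlgType k) (f : V -> S) a :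
  linear f -> linear (fun x => a * f x).
Proof. by move=> fL c x y; rewrite fL mulrDr pzscalerAr. Qed.

Lemma linear_mull_fun (S : pzAlgType k) (f : V -> S) a :
  linear f -> linear (fun x => f x * a).
Proof. by move=> fL c x y; rewrite fL mulrDl pzscalerAl. Qed.
End Linear.

(* [tensor_sum] sums over an arbitrary representative: a Sweedler sum commutes
   with linear maps and with other sums for free, but it is linear in the
   tensor it ranges over only when the summand is [balanced]. *)
Section Swd.
Variables (k : comPzRingType) (M N : lmodType k) (A : Type).
Variables (ra : M -> A -> M) (la : A -> N -> N).
Implicit Types V G : lmodType k.

Lemma linear_swd V G (f : V -> M -> N -> G) (x : tensor ra la) :
  (forall m n, linear (fun v => f v m n)) ->
  linear (fun v => \swd_(m, n <- x) f v m n).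
Proof.
move=> fL c v w; rewrite scaler_sumr -big_split /=.
by apply: eq_bigr => p _; rewrite fL.
Qed.

Lemma linear_swd_arg V G (f : M -> N -> G) (g : V -> tensor ra la) :
  balanced ra la f -> linear g -> linear (fun v => \swd_(m, n <- g v) f m n).
Proof. by move=> fB gL c v w; rewrite gL (tensor_sum_linear fB). Qed.

Lemma linear_tensl V (f : V -> M) n :
  linear f -> linear (fun v => tens ra la (f v) n).
Proof. by move=> fL c v w; rewrite fL (balanced_linl (tens_balanced ra la)). Qed.

Lemma linear_tensr V (f : V -> N) m :
  linear f -> linear (fun v => tens ra la m (f v)).
Proof. by move=> fL c v w; rewrite fL (balanced_linr (tens_balanced ra la)). Qed.

Lemma tens_act m a n : tens ra la (ra m a) n = tens ra la m (la a n).
Proof. exact: (balanced_act (tens_balanced ra la)). Qed.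

Lemma eq_swd (G : zmodType) (f g : M -> N -> G) (x : tensor ra la) :
  (forall m n, f m n = g m n) -> \swd_(m, n <- x) f m n = \swd_(m, n <- x) g m n.
Proof. by move=> fg; apply: eq_bigr => p _. Qed.

Lemma linear_swdE V G (h : V -> G) (f : M -> N -> V) (x : tensor ra la) :
  linear h -> h (\swd_(m, n <- x) f m n) = \swd_(m, n <- x) h (f m n).
Proof. by move=> hL; apply: (big_morph h (linear_funD hL) (linear_fun0 hL)). Qed.

Lemma mulr_swdr (S : pzAlgType k) (a : S) (f : M -> N -> S) (x : tensor ra la) :
  a * (\swd_(m, n <- x) f m n) = \swd_(m, n <- x) (a * f m n).
Proof. exact: (linear_swdE _ _ (linear_mulr_fun a (@linear_idfun k S))). Qed.

Lemma mulr_swdl (S : pzAlgType k) (a : S) (f : M -> N -> S) (x : tensor ra la) :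
  (\swd_(m, n <- x) f m n) * a = \swd_(m, n <- x) (f m n * a).
Proof. exact: (linear_swdE _ _ (linear_mull_fun a (@linear_idfun k S))). Qed.

(** By [tensor_sumE] a tensor is the sum of the pure tensors of its representative. Identities
    between linear maps out of tensor products are reduced to pure tensors in this way
    throughout. *)
Lemma tensor_ext G (g h : tensor ra la -> G) : linear g -> linear h ->
  (forall m n, g (tens ra la m n) = h (tens ra la m n)) -> g =1 h.
Proof.
move=> gL hL gh x; rewrite -[x]tensor_sumE !linear_swdE //.
exact: eq_swd.
Qed.

Lemma balanced_comp V G (h : V -> G) (f : M -> N -> V) : linear h ->
  balanced ra la f -> balanced ra la (fun m n => h (f m n)).
Proof.
move=> hL fB; split=> [n|m|m a n].
- by apply: linear_compfun hL _; apply: balanced_linl fB _.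
- by apply: linear_compfun hL _; apply: balanced_linr fB _.
- by rewrite (balanced_act fB).
Qed.
End Swd.

Section SwdComp.
Variables (k : comPzRingType) (M N : lmodType k) (A : Type).
Variables (ra : M -> A -> M) (la : A -> N -> N).

Lemma balanced_linl_comp (V G : lmodType k) (f : M -> N -> G) (g : V -> M) n :
  balanced ra la f -> linear g -> linear (fun v => f (g v) n).
Proof. by move=> fB gL; apply: linear_compfun (balanced_linl fB n) gL. Qed.

Lemma balanced_linr_comp (V G : lmodType k) (f : M -> N -> G) (g : V -> N) m :
  balanced ra la f -> linear g -> linear (fun v => f m (g v)).
Proof. by move=> fB gL; apply: linear_compfun (balanced_linr fB m) gL. Qed.

Lemma swd_swd (M' N' : lmodType k) (A' : Type) (ra' : M' -> A' -> M')
    (la' : A' -> N' -> N') (G : lmodType k) (f : M -> N -> G)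
    (x : tensor ra' la') (g : M' -> N' -> tensor ra la) : balanced ra la f ->
  \swd_(m, n <- \swd_(p, q <- x) g p q) f m n
  = \swd_(p, q <- x) \swd_(m, n <- g p q) f m n.
Proof. by move=> fB; apply: (linear_swdE _ _ (tensor_sum_linear fB)). Qed.

Lemma balanced_sum (M' N' : lmodType k) (A' : Type) (ra' : M' -> A' -> M')
    (la' : A' -> N' -> N') (G : lmodType k) (f : M -> N -> M' -> N' -> G)
    (y : tensor ra' la') : (forall p q, balanced ra la (fun m n => f m n p q)) ->
  balanced ra la (fun m n => \swd_(p, q <- y) f m n p q).
Proof.
move=> fB; split=> [n|m|m a n].
- by apply: linear_swd => p q; apply: (balanced_linl (fB p q)).
- by apply: linear_swd => p q; apply: (balanced_linr (fB p q)).
- by apply: eq_swd => p q; apply: (balanced_act (fB p q)).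
Qed.

Lemma tens_swdl (M' N' : lmodType k) (A' : Type) (ra' : M' -> A' -> M')
    (la' : A' -> N' -> N') (y : tensor ra' la') (f : M' -> N' -> M) n :
  tens ra la (\swd_(p, q <- y) f p q) n = \swd_(p, q <- y) tens ra la (f p q) n.
Proof. exact: (linear_swdE _ _ (balanced_linl (tens_balanced ra la) n)). Qed.

Lemma tens_swdr (M' N' : lmodType k) (A' : Type) (ra' : M' -> A' -> M')
    (la' : A' -> N' -> N') (y : tensor ra' la') (f : M' -> N' -> N) m :
  tens ra la m (\swd_(p, q <- y) f p q) = \swd_(p, q <- y) tens ra la m (f p q).
Proof. exact: (linear_swdE _ _ (balanced_linr (tens_balanced ra la) m)). Qed.

(** Turns an identity between tensors into one for every balanced [f], by applying the linear map
    that [f] induces to both sides. *)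
Lemma swd_tens_congr (M' N' : lmodType k) (A' : Type) (ra' : M' -> A' -> M')
    (la' : A' -> N' -> N') (G : lmodType k) (f : M -> N -> G)
    (x y : tensor ra' la') g h g' h' : balanced ra la f ->
  \swd_(p, q <- x) tens ra la (g p q) (h p q)
    = \swd_(p, q <- y) tens ra la (g' p q) (h' p q) ->
  \swd_(p, q <- x) f (g p q) (h p q) = \swd_(p, q <- y) f (g' p q) (h' p q).
Proof.
move=> fB /(congr1 (fun z : tensor ra la => tensor_sum z f)).
rewrite !(swd_swd _ _ fB) => e; apply: etrans (etrans e _).
  by apply: eq_swd => p q; rewrite (tensor_sum_tens fB).
by apply: eq_swd => p q; rewrite (tensor_sum_tens fB).
Qed.

Lemma exchange_swd (M' N' : lmodType k) (A' : Type) (ra' : M' -> A' -> M')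
    (la' : A' -> N' -> N') (G : zmodType) (f : M -> N -> M' -> N' -> G)
    (x : tensor ra la) (y : tensor ra' la') :
  \swd_(m, n <- x) \swd_(p, q <- y) f m n p q
  = \swd_(p, q <- y) \swd_(m, n <- x) f m n p q.
Proof. exact: exchange_big. Qed.
End SwdComp.

(* [lin] proves linearity up to the [balanced] conditions it meets, which are
   left as goals; [lin_ext] is redefined as new linear maps are introduced. *)
Ltac lin_ext := fail.

Ltac lin := cbv beta; lazymatch goal with
  | |- forall _, _ => intro; lin
  | |- GRing.linear_for _ (fun x => x) => exact: linear_idfun
  | |- GRing.linear_for _ (fun x => tensor_sum _ _) =>
      first [apply: linear_swd => ? ?; lin | apply: linear_swd_arg; [ | lin]]
  | |- GRing.linear_for _ (fun x => tens _ _ _ _) =>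
      first [apply: linear_tensl; lin | apply: linear_tensr; lin]
  | |- GRing.linear_for _ (fun x => _ * _) =>
      first [apply: linear_mulr_fun; lin | apply: linear_mull_fun; lin]
  | |- GRing.linear_for _ (fun x => counit ?B _) =>
      apply: (linear_compfun (counit_linear B)); lin
  | |- GRing.linear_for _ (fun x => comul ?B _) =>
      apply: (linear_compfun (comul_linear B)); lin
  | |- GRing.linear_for _ (fun x => src ?B _) =>
      apply: (linear_compfun (src_linear B)); lin
  | |- GRing.linear_for _ (fun x => tgt ?B _) =>
      apply: (linear_compfun (tgt_linear B)); lin
  | |- GRing.linear_for _ (fun x => coact ?C _) =>
      apply: (linear_compfun (coact_linear C)); lin
  | |- GRing.linear_for _ (fun x => cract ?C _ _) =>
      first [ apply: (linear_compfun (cract_linl C _)); lin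
            | apply: (linear_compfun (cract_linr C _)); lin]
  | |- GRing.linear_for _ (fun x => act ?C _ _) =>
      first [ apply: (linear_compfun (act_linl C _)); lin
            | apply: (linear_compfun (act_linr C _)); lin]
  | |- GRing.linear_for _ (fun x => tensU _ _ _) => rewrite /tensU; lin
  | |- GRing.linear_for _ (fun x => lact _ _ _) => rewrite /lact; lin
  | |- GRing.linear_for _ (fun x => ract _ _ _) => rewrite /ract; lin
  | fB : balanced _ _ ?f |- GRing.linear_for _ (fun x => ?f _ _) =>
      first [ apply: (balanced_linl_comp _ fB); lin
            | apply: (balanced_linr_comp _ fB); lin]
  | fL : GRing.linear_for _ ?f |- GRing.linear_for _ (fun x => ?f _) =>
      apply: (linear_compfun fL); lin
  | |- GRing.linear_for _ (fun x => _) => try lin_ext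
  | |- GRing.linear_for ?s ?f =>
      change (GRing.linear_for s (fun x => f x)); lin
  | _ => idtac
  end.

Ltac balance := split; [lin | lin | ].

(** * Sweedler calculus in a left bialgebroid *)

Section Bialgebroid.
Variables (k : comPzRingType) (A U : pzAlgType k) (B : left_bialgebroid A U).
Implicit Types (G : lmodType k).
Local Notation s := (src B).
Local Notation t := (tgt B).
Local Notation bal := (balanced (ract B) (lact B)).

Section Comul.
Variables (G : lmodType k) (f : U -> U -> G).
Hypothesis fB : bal f.

Lemma swd_comul1 : \swd_(p, q <- comul B 1) f p q = f 1 1.
Proof. by rewrite comul1 (tensor_sum_tens fB). Qed.

Lemma swd_comulM u v : \swd_(p, q <- comul B (u * v)) f p q
  = \swd_(v1, v2 <- comul B v) \swd_(u1, u2 <- comul B u) f (u1 * v1) (u2 * v2).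
Proof.
rewrite comulM (swd_swd _ _ fB); apply: eq_swd => v1 v2.
by rewrite (swd_swd _ _ fB); apply: eq_swd => u1 u2; rewrite (tensor_sum_tens fB).
Qed.

Lemma swd_comul_srcl a u : \swd_(p, q <- comul B (s a * u)) f p q
  = \swd_(u1, u2 <- comul B u) f (s a * u1) u2.
Proof.
rewrite -[s a * u]/(lact B a u) comul_lact (swd_swd _ _ fB).
by apply: eq_swd => u1 u2; rewrite (tensor_sum_tens fB).
Qed.

Lemma swd_takeuchi u a : \swd_(u1, u2 <- comul B u) f (u1 * t a) u2
  = \swd_(u1, u2 <- comul B u) f u1 (u2 * s a).
Proof. exact: (swd_tens_congr fB (comul_takeuchi B u a)). Qed.
End Comul.

Section ComulSrc.
Variables (G : lmodType k) (f : U -> U -> G).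
Hypothesis fB : bal f.

(** Left [A]-linearity of the coproduct and [comul1] give [comul (s a) = s a (x) 1]. *)
Lemma swd_comul_src a : \swd_(p, q <- comul B (s a)) f p q = f (s a) 1.
Proof.
rewrite -[s a]mulr1 (swd_comul_srcl fB) (swd_comul1 (f := fun p q => f (s a * p) q)) //.
balance; move=> m b n; rewrite /ract mulrA src_tgtC -mulrA.
exact: (balanced_act fB).
Qed.
End ComulSrc.

Section ComulSrcr.
Variables (G : lmodType k) (f : U -> U -> G).
Hypothesis fB : bal f.

Lemma bal_mulr v w : bal (fun p q => f (p * v) (q * w)).
Proof.
by balance; move=> m a n; rewrite /ract /lact -!mulrA; apply: (balanced_act fB).
Qed.

(** Multiplicativity reduces this to [comul (s a) = s a (x) 1]. Inserting that value in the inner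
    sum requires balancedness in [(p, q)], which is the Takeuchi condition for [u]. *)
Lemma swd_comul_srcr u a : \swd_(p, q <- comul B (u * s a)) f p q
  = \swd_(u1, u2 <- comul B u) f (u1 * s a) u2.
Proof.
rewrite (swd_comulM fB).
rewrite (swd_comul_src (f := fun p q => \swd_(u1, u2 <- comul B u) f (u1 * p) (u2 * q))).
  by apply: eq_swd => u1 u2; rewrite mulr1.
balance; move=> m b n; rewrite /ract /lact; under eq_swd do rewrite mulrA.
by under [RHS]eq_swd do rewrite mulrA; apply: (swd_takeuchi (bal_mulr m n)).
Qed.
End ComulSrcr.

Lemma swd_counitl (V : lmodType k) (h : U -> V) u : linear h ->
  \swd_(u1, u2 <- comul B u) h (s (counit B u1) * u2) = h u.
Proof. by move=> hL; rewrite -{2}[u](counitl B) linear_swdE. Qed.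

Lemma swd_counitr (V : lmodType k) (h : U -> V) u : linear h ->
  \swd_(u1, u2 <- comul B u) h (t (counit B u2) * u1) = h u.
Proof. by move=> hL; rewrite -{2}[u](counitr B) linear_swdE. Qed.

Lemma counit_srcl a u : counit B (s a * u) = a * counit B u.
Proof. exact: counit_lact. Qed.

Lemma counit_tgtl a u : counit B (t a * u) = counit B u * a.
Proof. exact: counit_ract. Qed.

Lemma counit_tgt a : counit B (t a) = a.
Proof. by rewrite -[t a]mulr1 counit_tgtl counit1 mul1r. Qed.

(** Descends a trilinear function, balanced at both tensor signs, to the iterated tensor product in
    which the coassociativity axioms are stated. *)
Lemma balanced_swd (M N : lmodType k) (ra : M -> A -> M) (la : A -> N -> N)
    (ra' : N -> A -> N) (W : lmodType k) (la' : A -> W -> W) G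
    (T : M -> N -> W -> G) :
  (forall w, balanced ra la (fun m n => T m n w)) ->
  (forall m n, linear (T m n)) ->
  (forall m n a w, T m (ra' n a) w = T m n (la' a w)) ->
  balanced (@tensor_ract k M N A ra la ra') la'
    (fun x w => \swd_(m, n <- x) T m n w).
Proof.
move=> TB TL TA; split=> [w|x|x a w].
- by apply: linear_swd_arg.
- by apply: linear_swd.
- rewrite /tensor_ract (swd_swd _ _ (TB w)); apply: eq_swd => m n.
  by rewrite (tensor_sum_tens (TB w)) TA.
Qed.

(** Coassociativity in usable form: apply to [comulA] the map that [T] induces on the triple tensor
    product. *)
Lemma swd_comulA G (T : U -> U -> U -> G) u :
  (forall w, bal (fun m n => T m n w)) ->
  (forall w, bal (T w)) ->
  \swd_(u1, u2 <- comul B u) \swd_(v1, v2 <- comul B u1) T v1 v2 u2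
  = \swd_(u1, u2 <- comul B u) \swd_(v1, v2 <- comul B u2) T u1 v1 v2.
Proof.
move=> TB1 TB2.
have FB : balanced (@tensor_ract k U U A (ract B) (lact B) (ract B)) (lact B)
    (fun x w => \swd_(m, n <- x) T m n w).
  apply: balanced_swd => // [m n|m n a w]; first exact: (balanced_linr (TB2 m)).
  exact: (balanced_act (TB2 m)).
have := congr1 (fun x => tensor_sum x (fun x w => \swd_(m, n <- x) T m n w)) (comulA B u).
rewrite !(swd_swd _ _ FB).
under eq_swd do rewrite (swd_swd _ _ FB).
under [in RHS]eq_swd do rewrite (swd_swd _ _ FB).
under eq_swd do under eq_swd do rewrite (tensor_sum_tens FB) (tensor_sum_tens (TB1 _)).
under [in RHS]eq_swd do under eq_swd do
  rewrite (tensor_sum_tens FB) (tensor_sum_tens (TB1 _)).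
by [].
Qed.

(** * Sweedler calculus for a right comodule *)

Section Comodule.
Variables (M : lmodType k) (C : right_comodule B M).

Lemma swd_coactA G (T : M -> U -> U -> G) m :
  (forall w, balanced (cract C) (lact B) (fun m n => T m n w)) ->
  (forall w, bal (T w)) ->
  \swd_(m0, m1 <- coact C m) \swd_(n0, n1 <- coact C m0) T n0 n1 m1
  = \swd_(m0, m1 <- coact C m) \swd_(u1, u2 <- comul B m1) T m0 u1 u2.
Proof.
move=> TB1 TB2.
have FB : balanced (@tensor_ract k M U A (cract C) (lact B) (ract B)) (lact B)
    (fun x w => \swd_(m, n <- x) T m n w).
  apply: balanced_swd => // [n u|n u a w]; first exact: (balanced_linr (TB2 n)).
  exact: (balanced_act (TB2 n)).
have := congr1 (fun x => tensor_sum x (fun x w => \swd_(m, n <- x) T m n w)) (coactA C m).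
rewrite !(swd_swd _ _ FB).
under eq_swd do rewrite (swd_swd _ _ FB).
under [in RHS]eq_swd do rewrite (swd_swd _ _ FB).
under eq_swd do under eq_swd do rewrite (tensor_sum_tens FB) (tensor_sum_tens (TB1 _)).
under [in RHS]eq_swd do under eq_swd do
  rewrite (tensor_sum_tens FB) (tensor_sum_tens (TB1 _)).
by [].
Qed.

Lemma swd_coact_cract G (f : M -> U -> G) a m : balanced (cract C) (lact B) f ->
  \swd_(m0, m1 <- coact C (cract C m a)) f m0 m1
  = \swd_(m0, m1 <- coact C m) f m0 (t a * m1).
Proof.
move=> fB; rewrite coact_cract (swd_swd _ _ fB).
by apply: eq_swd => m0 m1; rewrite (tensor_sum_tens fB).
Qed.
End Comodule.
End Bialgebroid.

(** * The algebra R # U *)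

Section YDAlgebra.
Variables (k : comPzRingType) (A U : pzAlgType k) (B : left_bialgebroid A U).
Variables (R : pzAlgType k) (Y : yd_algebra B R).
Implicit Types (G : lmodType k) (r : R) (u : U).
Local Notation s := (src B).
Local Notation t := (tgt B).
Local Notation balU := (balanced (ract B) (lact B)).
Local Notation balR := (balanced (cract Y) (lact B)).

(* This is [1 <| a]; both A-actions on [R] are multiplications by these elements. *)
Definition tgt_unit a : R := act Y (t a) 1.

(** The left [A]-action commutes with right multiplication, so its value at 1 determines it;
    [yda_act1] at [t a], whose counit is [a], identifies [s a] and [t a] acting on 1. *)
Lemma act_src a r : act Y (s a) r = tgt_unit a * r.
Proof.
rewrite -{1}[r]mul1r -yd_lact yda_lactM yd_lact; congr (_ * _).
by rewrite /tgt_unit [RHS]yda_act1 counit_tgt.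
Qed.

Lemma act_tgt a r : act Y (t a) r = r * tgt_unit a.
Proof. by rewrite -{1}[r]mulr1 -yd_ract yda_ractM yd_ract. Qed.

Lemma cractE r a : cract Y r a = r * tgt_unit a.
Proof. by rewrite yd_ract act_tgt. Qed.

Lemma clactE a r : clact Y a r = tgt_unit a * r.
Proof. by rewrite yd_lact act_src. Qed.

Lemma tgt_unit_linear : linear tgt_unit.
Proof. by rewrite /tgt_unit; lin. Qed.

Lemma tgt_unitM a b : tgt_unit (a * b) = tgt_unit a * tgt_unit b.
Proof. by rewrite {1}/tgt_unit tgtM actM act_tgt. Qed.

Lemma swd_coact1 G (f : R -> U -> G) : balR f ->
  \swd_(p, q <- coact Y 1) f p q = f 1 1.
Proof. by move=> fB; rewrite yda_coact1 (tensor_sum_tens fB). Qed.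

Section BalancedCoact.
Variables (G : lmodType k) (f : R -> U -> G).
Hypothesis fB : balR f.

Lemma balR_act r a u : f (r * tgt_unit a) u = f r (s a * u).
Proof. by rewrite -cractE (balanced_act fB). Qed.

(** The factor [t a] acts by right multiplication by [tgt_unit a], which crosses the tensor sign of
    [f] as [s a]. *)
Lemma balU_act r r' w : balU (fun u1 u2 => f (r * act Y u1 r') (u2 * w)).
Proof.
by balance; move=> u1 a u2; rewrite /ract actM act_tgt mulrA balR_act mulrA.
Qed.

Lemma swd_coactM r r' : \swd_(p, q <- coact Y (r * r')) f p q
  = \swd_(r0, r1 <- coact Y r) \swd_(r0', r1' <- coact Y r') f (r0 * r0') (r1' * r1).
Proof.
rewrite yda_coactM (swd_swd _ _ fB); apply: eq_swd => r0 r1.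
by rewrite (swd_swd _ _ fB); apply: eq_swd => r0' r1'; rewrite (tensor_sum_tens fB).
Qed.

Lemma swd_coact_tgt_unit a r : \swd_(p, q <- coact Y (r * tgt_unit a)) f p q
  = \swd_(r0, r1 <- coact Y r) f r0 (t a * r1).
Proof. by rewrite -cractE (swd_coact_cract _ _ fB). Qed.

Lemma swd_yd u r : \swd_(r0, r1 <- coact Y r) \swd_(u1, u2 <- comul B u)
    f (act Y u1 r0) (u2 * r1)
  = \swd_(u1, u2 <- comul B u) \swd_(n0, n1 <- coact Y (act Y u2 r)) f n0 (n1 * u1).
Proof.
have := congr1 (fun x => tensor_sum x f) (yd_compat Y u r).
rewrite !(swd_swd _ _ fB) => e.
under eq_swd do under eq_swd do rewrite -(tensor_sum_tens fB).
under eq_swd do rewrite -(swd_swd _ _ fB).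
rewrite e; apply: eq_swd => u1 u2; rewrite (swd_swd _ _ fB).
by apply: eq_swd => n0 n1; rewrite (tensor_sum_tens fB).
Qed.
End BalancedCoact.

(** * Product and unit of [R # U] *)

Definition smash_mul_pure r u r' u' : smash Y :=
  \swd_(u1, u2 <- comul B u) tens (cract Y) (lact B) (r * act Y u1 r') (u2 * u').

Definition smash_mul (x y : smash Y) : smash Y :=
  \swd_(r, u <- (x : tensor (cract Y) (lact B)))
  \swd_(r', u' <- (y : tensor (cract Y) (lact B))) smash_mul_pure r u r' u'.

(** Writing the right action on [r'] as the action of [t a] produces [u1 * t a], which the Takeuchi
    condition of [U] trades for [u2 * s a]. *)
Lemma smash_mul_pure_balr r u : balR (smash_mul_pure r u).
Proof.
have fB := tens_balanced (cract Y) (lact B).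
rewrite /smash_mul_pure; balance; move=> r' a u'.
under eq_swd do rewrite yd_ract -actM.
rewrite (swd_takeuchi (f := fun u1 u2 =>
  tens (cract Y) (lact B) (r * act Y u1 r') (u2 * u'))); last exact: (balU_act fB).
by apply: eq_swd => u1 u2; rewrite /lact mulrA.
Qed.

(** Left [A]-linearity of the coproduct puts [s a] on [u1], where it acts by left multiplication by
    [tgt_unit a]. *)
Lemma smash_mul_pure_ball r' u' : balR (fun r u => smash_mul_pure r u r' u').
Proof.
have fB := tens_balanced (cract Y) (lact B).
rewrite /smash_mul_pure; balance.
  exact: (balU_act fB).
move=> r a u; rewrite /lact swd_comul_srcl; last exact: (balU_act fB).
by apply: eq_swd => u1 u2; rewrite cractE actM act_src mulrA.
Qed.

Lemma smash_mul_tens r u r' u' :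
  smash_mul (tens (cract Y) (lact B) r u) (tens (cract Y) (lact B) r' u')
  = smash_mul_pure r u r' u'.
Proof.
rewrite /smash_mul tensor_sum_tens ?(tensor_sum_tens (smash_mul_pure_balr _ _)) //.
exact/balanced_sum/smash_mul_pure_ball.
Qed.

Lemma smash_mul_linl y : linear (smash_mul^~ y).
Proof. by apply/tensor_sum_linear/balanced_sum/smash_mul_pure_ball. Qed.

Lemma smash_mul_linr x : linear (smash_mul x).
Proof. by rewrite /smash_mul; lin; apply: smash_mul_pure_balr. Qed.

Lemma smash_ext G (g h : smash Y -> G) : linear g -> linear h ->
  (forall r u, g (tens (cract Y) (lact B) r u) = h (tens (cract Y) (lact B) r u)) ->
  g =1 h.
Proof. exact: tensor_ext. Qed.

Ltac lin_ext ::= lazymatch goal with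
  | |- GRing.linear_for _ (fun x => smash_mul _ _) =>
      first [ apply: (linear_compfun (smash_mul_linr _)); lin
            | apply: (linear_compfun (smash_mul_linl _)); lin]
  end.

(** Both sides equal [r (u1 r') (u2 v1 r'') (x) u3 v2 u''], with [v] the coproduct legs of [u']: the
    left by multiplicativity of the coproduct, the right by the action on a product. Coassociativity
    at [u] matches them. *)
Lemma smash_mul_pureA r u r' u' r'' u'' :
  smash_mul (smash_mul_pure r u r' u') (tens (cract Y) (lact B) r'' u'')
  = smash_mul (tens (cract Y) (lact B) r u) (smash_mul_pure r' u' r'' u'').
Proof.
have fB := tens_balanced (cract Y) (lact B).
rewrite /smash_mul_pure (linear_swdE _ _ (smash_mul_linl _)).
rewrite (linear_swdE _ _ (smash_mul_linr _)).
under eq_swd do rewrite smash_mul_tens.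
under [RHS]eq_swd do rewrite smash_mul_tens.
rewrite /smash_mul_pure.
under eq_swd do rewrite (swd_comulM (balU_act fB _ _ _)).
under [RHS]eq_swd => v1 v2.
  under eq_swd => u1 u2.
    rewrite yda_actM mulr_swdr tens_swdl.
  over. over.
cbv beta; rewrite exchange_swd; apply: eq_swd => v1 v2.
rewrite -(swd_comulA (T := fun a b c => tens (cract Y) (lact B)
  (r * act Y a r' * act Y (b * v1) r'') (c * v2 * u''))).
- by apply: eq_swd => u1 u2; apply: eq_swd => w1 w2; rewrite actM !mulrA.
- move=> w; balance; move=> a c b; rewrite /ract /lact -mulrA actM act_tgt.
  by rewrite -!(mulrA _ (tgt_unit _)) -act_src -!actM !mulrA.
- move=> w; balance; move=> a c b.
  by rewrite /ract /lact -[_ * a * v1]mulrA actM act_tgt mulrA (balR_act fB) !mulrA.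
Qed.

Lemma smash_mulA : associative smash_mul.
Proof.
move=> x y z; apply: (smash_ext (g := fun x => smash_mul x (smash_mul y z))
  (h := fun x => smash_mul (smash_mul x y) z)); [by lin | by lin | move=> r u].
apply: (smash_ext (g := fun y => smash_mul _ (smash_mul y z))
  (h := fun y => smash_mul (smash_mul _ y) z)); [by lin | by lin | move=> r' u'].
apply: (smash_ext (g := fun z => smash_mul _ (smash_mul _ z))
  (h := fun z => smash_mul (smash_mul _ _) z)); [by lin | by lin | move=> r'' u''].
by rewrite !smash_mul_tens smash_mul_pureA.
Qed.

Definition smash_one : smash Y := tens (cract Y) (lact B) 1 1.

Lemma smash_mul1x : left_id smash_one smash_mul.
Proof.
have fB := tens_balanced (cract Y) (lact B).
apply: (smash_ext (g := fun x => smash_mul _ x)) => [|//|r u]; first by lin.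
rewrite smash_mul_tens /smash_mul_pure (swd_comul1 (balU_act fB _ _ _)).
by rewrite act1 !mul1r.
Qed.

Lemma smash_mulx1 : right_id smash_one smash_mul.
Proof.
have fB := tens_balanced (cract Y) (lact B).
apply: (smash_ext (g := fun x => smash_mul x _)) => [|//|r u]; first by lin.
rewrite smash_mul_tens /smash_mul_pure.
(* The action of [u1] on 1 is [tgt_unit (counit B u1)]; it crosses to [u2] as [s (counit B u1)],
   where the left counit axiom collapses the sum. *)
under eq_swd do rewrite mulr1 yda_act1 -/(tgt_unit _) act_src mulr1 (balR_act fB).
by rewrite -tens_swdr counitl.
Qed.

(** Transparent, so that the product and unit of [smashA] unfold to [smash_mul] and [smash_one]. *)
Definition smash_alg : alg_on (smash Y).
Proof.
apply: (AlgOn smash_mulA smash_mul1x smash_mulx1).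
- by move=> x y z; apply: linear_funD (smash_mul_linl _) _ _.
- by move=> x y z; apply: linear_funD (smash_mul_linr _) _ _.
- by move=> c x y; rewrite (linear_funZ _ _ (smash_mul_linl _)).
- by move=> c x y; rewrite (linear_funZ _ _ (smash_mul_linr _)).
Defined.

Definition smashA : pzAlgType k := PzAlg smash_alg.
Definition smash_tens r u : smashA := tens (cract Y) (lact B) r u.

Lemma pure_balanced : balR smash_tens.
Proof. exact: tens_balanced. Qed.

Lemma pure_ext G (g h : smashA -> G) : linear g -> linear h ->
  (forall r u, g (smash_tens r u) = h (smash_tens r u)) -> g =1 h.
Proof. exact: tensor_ext. Qed.

Lemma pureM r u r' u' : smash_tens r u * smash_tens r' u' =
  \swd_(u1, u2 <- comul B u) smash_tens (r * act Y u1 r') (u2 * u').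
Proof. exact: smash_mul_tens. Qed.

Lemma pure1 : smash_tens 1 1 = 1. Proof. by []. Qed.

Lemma pure_tgt_unit r a u : smash_tens (r * tgt_unit a) u = smash_tens r (s a * u).
Proof. exact: (balR_act pure_balanced). Qed.
End YDAlgebra.

Ltac lin_smash := lazymatch goal with
  | |- GRing.linear_for _ (fun x => smash_tens _ _ _) =>
      first [ apply: (balanced_linl_comp _ (pure_balanced _)); lin
            | apply: (balanced_linr_comp _ (pure_balanced _)); lin]
  | |- GRing.linear_for _ (fun x => tgt_unit _ _) =>
      apply: (linear_compfun (tgt_unit_linear _)); lin
  end.

Ltac lin_ext ::= lin_smash.

(** * The left bialgebroid R # U *)

Section SmashBialgebroid.
Variables (k : comPzRingType) (A U : pzAlgType k) (B : left_bialgebroid A U).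
Variables (R : pzAlgType k) (Y : yd_algebra B R).
Hypothesis hY : braided_commutative Y.
Implicit Types (G : lmodType k) (r : R) (u : U).
Local Notation s := (src B).
Local Notation t := (tgt B).
Local Notation balU := (balanced (ract B) (lact B)).
Local Notation balR := (balanced (cract Y) (lact B)).
Local Notation H := (smashA Y).
Local Notation tunit := (tgt_unit Y).
Local Notation pure := (@smash_tens k A U B R Y).

(** * Source and target maps of [R # U] *)

Definition smash_src r : H := pure r 1.
Definition smash_tgt r : H := \swd_(r0, r1 <- coact Y r) pure r0 r1.
Definition smash_lact r (x : H) : H := smash_src r * x.
Definition smash_ract (x : H) r : H := smash_tgt r * x.
Local Notation S := smash_src.
Local Notation T := smash_tgt.
Local Notation balH := (balanced smash_ract smash_lact).
Local Notation tensH := (tens smash_ract smash_lact).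

Lemma smash_src_linear : linear S.
Proof. by rewrite /S; lin. Qed.

Lemma smash_tgt_linear : linear T.
Proof. by rewrite /T; lin; apply: pure_balanced. Qed.

Lemma balR_pure r u : balR (fun p q => pure (r * p) (q * u)).
Proof.
balance; move=> p a q.
by rewrite cractE mulrA pure_tgt_unit /lact mulrA.
Qed.

Lemma pure_swdl (M N : lmodType k) (X : Type) (ra : M -> X -> M) (la : X -> N -> N)
    (y : tensor ra la) (f : M -> N -> R) u :
  pure (\swd_(p, q <- y) f p q) u = \swd_(p, q <- y) pure (f p q) u.
Proof. exact: (linear_swdE _ _ (balanced_linl (pure_balanced Y) u)). Qed.

(** The action of [u1] on 1 only contributes [counit B u1], which the left counit axiom absorbs. At
    [r = 1] this says that [u |-> 1 (x) u] is multiplicative. *)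
Lemma pure_mulr r u v : pure r u * pure 1 v = pure r (u * v).
Proof.
rewrite pureM.
under eq_swd do
  rewrite yda_act1 -/(tgt_unit Y _) act_src mulr1 pure_tgt_unit mulrA.
rewrite (swd_counitl B (h := fun w => pure r (w * v))) //.
by lin.
Qed.

Lemma smash_srcM r r' : S (r * r') = S r * S r'.
Proof.
rewrite /S pureM (swd_comul1 (balU_act (pure_balanced Y) _ _ _)).
by rewrite act1 mulr1.
Qed.

Lemma smash_src_pure r r' u : S r * pure r' u = pure (r * r') u.
Proof.
rewrite /S pureM (swd_comul1 (balU_act (pure_balanced Y) _ _ _)).
by rewrite act1 mul1r.
Qed.

Lemma pure_src r r' u : pure r u * S r' =
  \swd_(u1, u2 <- comul B u) pure (r * act Y u1 r') u2.
Proof. by rewrite /S pureM; apply: eq_swd => u1 u2; rewrite mulr1. Qed.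

(* Coassociativity of the coaction exhibits the factor [r'_0 (r'_1 r)], which
   braided commutativity contracts to [r r']. *)
Lemma smash_tgt_pure r' r u :
  T r' * pure r u = \swd_(r0, r1 <- coact Y r') pure (r * r0) (r1 * u).
Proof.
rewrite /T mulr_swdl.
under eq_swd do rewrite pureM.
rewrite -(swd_coactA (T := fun (m : R) v1 v2 => pure (m * act Y v1 r) (v2 * u))).
- apply: eq_swd => r0 r1; rewrite -pure_swdl; congr pure.
  exact/esym/hY.
- by move=> w; balance; move=> m a v; rewrite cractE /lact actM act_src mulrA.
- by move=> w; apply: (balU_act (pure_balanced Y)).
Qed.

(** By [smash_tgt_pure] the right side is the sum of [r_0 r'_0 (x) r'_1 r_1], the coaction of
    [r r']; the reversed order of its second legs makes [T] antimultiplicative. *)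
Lemma smash_tgtM r r' : T (r * r') = T r' * T r.
Proof.
rewrite {3}/T mulr_swdr.
under eq_swd do rewrite smash_tgt_pure.
by rewrite /T (swd_coactM (pure_balanced Y)).
Qed.

Lemma smash_src_tgtC r r' : S r * T r' = T r' * S r.
Proof.
rewrite smash_tgt_pure /T mulr_swdr; apply: eq_swd => r0 r1.
by rewrite smash_src_pure mulr1.
Qed.

Lemma smash_src1 : S 1 = 1. Proof. by []. Qed.

Lemma smash_tgt1 : T 1 = 1.
Proof. by rewrite /T (swd_coact1 (pure_balanced Y)). Qed.

(** The coaction is right [A]-linear and fixes the unit, so [T (tunit a)] is [1 (x) t a]. With
    [pure_srcl] this relates balancing over [A] in [U] to balancing over [R] in [H]. *)
Lemma pure_tgtl r a u : pure r (t a * u) = T (tunit a) * pure r u.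
Proof.
rewrite smash_tgt_pure -[tunit a]mul1r.
rewrite (swd_coact_tgt_unit (balR_pure r u)).
have fB : balR (fun p q => pure (r * p) (t a * q * u)).
  balance; move=> p b q; rewrite cractE mulrA pure_tgt_unit /lact.
  by rewrite !mulrA src_tgtC.
by rewrite (swd_coact1 fB) !mulr1.
Qed.

Lemma pure_srcl a u : pure 1 (s a * u) = S (tunit a) * pure 1 u.
Proof. by rewrite smash_src_pure mulr1 -pure_tgt_unit mul1r. Qed.

Lemma tens_smash r (x y : H) : tensH (T r * x) y = tensH x (S r * y).
Proof. exact: tens_act. Qed.

(** * Coproduct and counit of [R # U] *)

Section ComulDef.
Variables (G : lmodType k) (f : H -> H -> G).
Hypothesis fB : balH f.

Lemma balH_tgt r x y : f (T r * x) y = f x (S r * y).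
Proof. exact: (balanced_act fB). Qed.

(** Moving [a] across the tensor over [A] is moving [tunit a] across the tensor over [R]. *)
Lemma balU_pure r : balU (fun u1 u2 => f (pure r u1) (pure 1 u2)).
Proof.
by balance; move=> u1 a u2; rewrite /ract /lact pure_tgtl pure_srcl balH_tgt.
Qed.

Lemma balR_comul : balR (fun r u =>
  \swd_(u1, u2 <- comul B u) f (pure r u1) (pure 1 u2)).
Proof.
balance; first exact: balU_pure.
move=> r a u; rewrite /lact (swd_comul_srcl (balU_pure r)).
by apply: eq_swd => u1 u2; rewrite cractE pure_tgt_unit.
Qed.
End ComulDef.

Definition smash_comul (x : H) : tensor smash_ract smash_lact :=
  \swd_(r, u <- (x : tensor (cract Y) (lact B)))
  \swd_(u1, u2 <- comul B u) tensH (pure r u1) (pure 1 u2).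

Definition smash_counit (x : H) : R :=
  \swd_(r, u <- (x : tensor (cract Y) (lact B))) (r * tunit (counit B u)).

Lemma smash_comul_pure r u : smash_comul (pure r u) =
  \swd_(u1, u2 <- comul B u) tensH (pure r u1) (pure 1 u2).
Proof. exact/tensor_sum_tens/balR_comul/tens_balanced. Qed.

Lemma smash_comul_linear : linear smash_comul.
Proof. exact/tensor_sum_linear/balR_comul/tens_balanced. Qed.

Lemma balR_counit : balR (fun r u => r * tunit (counit B u)).
Proof.
by balance; move=> r a u; rewrite cractE /lact counit_srcl tgt_unitM mulrA.
Qed.

Lemma smash_counit_pure r u : smash_counit (pure r u) = r * tunit (counit B u).
Proof. exact: (tensor_sum_tens balR_counit). Qed.

Lemma smash_counit_linear : linear smash_counit.
Proof. exact: (tensor_sum_linear balR_counit). Qed.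

Lemma swd_smash_comul G (f : H -> H -> G) r u : balH f ->
  \swd_(x, y <- smash_comul (pure r u)) f x y =
  \swd_(u1, u2 <- comul B u) f (pure r u1) (pure 1 u2).
Proof.
move=> fB; rewrite smash_comul_pure (swd_swd _ _ fB).
by apply: eq_swd => u1 u2; rewrite (tensor_sum_tens fB).
Qed.

Ltac lin_ext ::= first [lin_smash | lazymatch goal with
  | |- GRing.linear_for _ (fun x => smash_src _) =>
      apply: (linear_compfun smash_src_linear); lin
  | |- GRing.linear_for _ (fun x => smash_tgt _) =>
      apply: (linear_compfun smash_tgt_linear); lin
  | |- GRing.linear_for _ (fun x => smash_comul _) =>
      apply: (linear_compfun smash_comul_linear); lin
  | |- GRing.linear_for _ (fun x => smash_counit _) =>
      apply: (linear_compfun smash_counit_linear); lin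
  | |- GRing.linear_for _ (fun x => smash_lact _ _) => rewrite /smash_lact; lin
  | |- GRing.linear_for _ (fun x => smash_ract _ _) => rewrite /smash_ract; lin
  end].

Let tB : balH tensH := tens_balanced _ _.

Lemma smash_comul_lact r (x : H) : smash_comul (smash_lact r x) =
  \swd_(x1, x2 <- smash_comul x) tensH (smash_lact r x1) x2.
Proof.
have fB : balH (fun x1 x2 => tensH (smash_lact r x1) x2).
  balance; move=> y a z; rewrite /smash_lact /smash_ract mulrA smash_src_tgtC -mulrA.
  exact: tens_smash.
move: x; apply: (pure_ext (g := fun x => smash_comul (smash_lact r x))
  (h := fun x => \swd_(x1, x2 <- smash_comul x) tensH (smash_lact r x1) x2)).
- by lin.
- by lin.
move=> r' u; rewrite (swd_smash_comul _ _ fB) /smash_lact smash_src_pure smash_comul_pure.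
by apply: eq_swd => u1 u2; rewrite smash_src_pure.
Qed.

Lemma tens_pure (x : H) r u : tensH x (pure r u) = tensH (T r * x) (pure 1 u).
Proof. by rewrite tens_smash smash_src_pure mulr1. Qed.

(** [smash_tgt_pure] turns [T r * (r' (x) u)] into [r' r_0 (x) r_1 u]. The coproduct then splits
    [r_1], and coassociativity of the coaction replaces this by a second coaction of [r_0]; it
    reassembles into [T r_0] on the first leg, which crosses as [S r_0] and leaves [T r] on the
    second. *)
Lemma smash_comul_ract (x : H) r : smash_comul (smash_ract x r) =
  \swd_(x1, x2 <- smash_comul x) tensH x1 (smash_ract x2 r).
Proof.
have fB : balH (fun x1 x2 => tensH x1 (smash_ract x2 r)).
  balance; move=> y a z; rewrite /smash_ract /smash_lact tens_smash mulrA.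
  by rewrite smash_src_tgtC mulrA.
move: x; apply: (pure_ext (g := fun x => smash_comul (smash_ract x r))
  (h := fun x => \swd_(x1, x2 <- smash_comul x) tensH x1 (smash_ract x2 r))).
- by lin.
- by lin.
move=> r' u; rewrite (swd_smash_comul _ _ fB) /smash_ract smash_tgt_pure.
rewrite (linear_swdE _ _ smash_comul_linear).
under eq_swd do rewrite smash_comul_pure (swd_comulM (balU_pure tB _)).
under eq_swd do rewrite exchange_swd.
rewrite -(swd_coactA (T := fun (m : R) v1 v2 => \swd_(u1, u2 <- comul B u)
  tensH (pure (r' * m) (v1 * u1)) (pure 1 (v2 * u2)))).
- under [RHS]eq_swd do rewrite smash_tgt_pure tens_swdr.
  rewrite [RHS]exchange_swd; apply: eq_swd => r0 r1.
  rewrite exchange_swd; apply: eq_swd => u1 u2.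
  by rewrite mul1r tens_pure smash_tgt_pure tens_swdl.
- move=> w; apply: balanced_sum => u1 u2.
  apply: (balanced_comp (h := fun z => tensH z _) _ (balR_pure _ _)).
  exact: (balanced_linl tB).
- move=> m; apply: balanced_sum => u1 u2.
  exact: (bal_mulr (balU_pure tB _)).
Qed.

Lemma smash_counit_lact r (x : H) :
  smash_counit (smash_lact r x) = r * smash_counit x.
Proof.
move: x; apply: (pure_ext (g := fun x => smash_counit (smash_lact r x))
  (h := fun x => r * smash_counit x)); [by lin | by lin | move=> r' u].
by rewrite /smash_lact smash_src_pure !smash_counit_pure mulrA.
Qed.

(** Once [counit (r_1 u)] is rewritten as [counit (r_1 * s (counit u))], the sum over the coaction
    of [r] is [clact], the induced left action of [counit u] on [r], hence left multiplication by
    [tunit (counit u)]. *)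
Lemma smash_counit_ract (x : H) r :
  smash_counit (smash_ract x r) = smash_counit x * r.
Proof.
move: x; apply: (pure_ext (g := fun x => smash_counit (smash_ract x r))
  (h := fun x => smash_counit x * r)); [by lin | by lin | move=> r' u].
rewrite /smash_ract smash_tgt_pure (linear_swdE _ _ smash_counit_linear).
rewrite smash_counit_pure -mulrA -clactE /clact mulr_swdr.
by apply: eq_swd => r0 r1; rewrite smash_counit_pure cractE mulrA -counitM_src.
Qed.

Lemma smash_counitl (x : H) :
  \swd_(x1, x2 <- smash_comul x) smash_lact (smash_counit x1) x2 = x.
Proof.
have fB : balH (fun x1 x2 => smash_lact (smash_counit x1) x2).
  balance; move=> y a z; rewrite smash_counit_ract /smash_lact mulrA.
  by rewrite smash_srcM.
move: x; apply: (pure_ext (g := fun x => \swd_(x1, x2 <- smash_comul x)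
  smash_lact (smash_counit x1) x2) (h := fun x => x)); [by lin | by lin | move=> r u].
rewrite (swd_smash_comul _ _ fB).
under eq_swd do
  rewrite /smash_lact smash_counit_pure smash_src_pure mulr1 pure_tgt_unit.
by rewrite (swd_counitl B (h := pure r)) //; lin.
Qed.

Lemma smash_counitr (x : H) :
  \swd_(x1, x2 <- smash_comul x) smash_ract x1 (smash_counit x2) = x.
Proof.
have fB : balH (fun x1 x2 => smash_ract x1 (smash_counit x2)).
  balance; move=> y a z; rewrite smash_counit_lact /smash_ract mulrA.
  by rewrite smash_tgtM.
move: x; apply: (pure_ext (g := fun x => \swd_(x1, x2 <- smash_comul x)
  smash_ract x1 (smash_counit x2)) (h := fun x => x)); [by lin | by lin | move=> r u].
rewrite (swd_smash_comul _ _ fB).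
under eq_swd do rewrite /smash_ract smash_counit_pure mul1r -pure_tgtl.
by rewrite (swd_counitr B (h := pure r)) //; lin.
Qed.

(** * Coassociativity of the coproduct of [R # U] *)

Local Notation ractHH := (@tensor_ract k H H R smash_ract smash_lact smash_ract).
Local Notation tensHH := (tens ractHH smash_lact).

Lemma tensHH_smash (x y z : H) r :
  tensHH (tensH x (T r * y)) z = tensHH (tensH x y) (S r * z).
Proof.
rewrite -[S r * z]/(smash_lact r z) -tens_act; congr (tens _ _ _ _).
rewrite /tensor_ract (tensor_sum_tens (f := fun m n => tensH m (smash_ract n r))) //.
balance; move=> y' a z'; rewrite /smash_ract /smash_lact tens_smash mulrA.
by rewrite smash_src_tgtC mulrA.
Qed.

(** On [r (x) u] the two sides are images of the two iterated coproducts of [u] under [a (x) b (x) c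
    |-> (r (x) a) (x) (1 (x) b) (x) (1 (x) c)]. *)
Lemma smash_comulA (x : H) :
  \swd_(x1, x2 <- smash_comul x) \swd_(y1, y2 <- smash_comul x1)
    tensHH (tensH y1 y2) x2
  = \swd_(x1, x2 <- smash_comul x) \swd_(y1, y2 <- smash_comul x2)
    tensHH (tensH x1 y1) y2.
Proof.
have B1 z : balH (fun y1 y2 => tensHH (tensH y1 y2) z).
  by balance; move=> y1 a y2; rewrite /smash_ract tens_smash.
have B2 z : balH (fun y1 y2 => tensHH (tensH z y1) y2).
  by balance; move=> y1 a y2; apply: tensHH_smash.
(* The coproduct carries [T a] from [x1] to its second leg [y2], next to [x2], where [tensHH_smash]
   moves it across. *)
have B3 : balH (fun x1 x2 => \swd_(y1, y2 <- smash_comul x1) tensHH (tensH y1 y2) x2).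
  balance; first exact: B1.
  move=> x1 a x2; rewrite smash_comul_ract [LHS](swd_swd _ _ (B1 _)).
  apply: eq_swd => y1 y2; rewrite (tensor_sum_tens (B1 _)); exact: tensHH_smash.
have B4 : balH (fun x1 x2 => \swd_(y1, y2 <- smash_comul x2) tensHH (tensH x1 y1) y2).
  balance; first exact: B2.
  move=> x1 a x2; rewrite smash_comul_lact [RHS](swd_swd _ _ (B2 _)).
  apply: eq_swd => y1 y2; rewrite (tensor_sum_tens (B2 _)).
  by rewrite /smash_ract tens_smash.
move: x; apply: (pure_ext (g := fun x => \swd_(x1, x2 <- smash_comul x)
    \swd_(y1, y2 <- smash_comul x1) tensHH (tensH y1 y2) x2)
  (h := fun x => \swd_(x1, x2 <- smash_comul x)
    \swd_(y1, y2 <- smash_comul x2) tensHH (tensH x1 y1) y2)); [by lin | by lin | move=> r u].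
rewrite (swd_smash_comul _ _ B3) (swd_smash_comul _ _ B4).
under eq_swd do rewrite (swd_smash_comul _ _ (B1 _)).
under [RHS]eq_swd do rewrite (swd_smash_comul _ _ (B2 _)).
apply: (swd_comulA (T := fun a b c =>
  tensHH (tensH (pure r a) (pure 1 b)) (pure 1 c))) => w.
  exact: (balU_pure (B1 _)).
by balance; move=> a c b; rewrite /ract /lact pure_tgtl tensHH_smash pure_srcl.
Qed.

(** * Takeuchi condition and multiplicativity of the coproduct and counit *)

Lemma smash_comul1 : smash_comul 1 = tensH 1 1.
Proof. by rewrite -pure1 smash_comul_pure (swd_comul1 (balU_pure tB _)). Qed.

Lemma smash_counit1 : smash_counit 1 = 1.
Proof.
by rewrite -pure1 smash_counit_pure counit1 mul1r /tgt_unit tgt1 act1.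
Qed.

(** The Yetter-Drinfeld condition read in [R # U]: the left side expands by [smash_tgt_pure] to
    [r (u2 r')_0 (x) (u2 r')_1 u1], the right side to [r (u1 r'_0) (x) u2 r'_1]. *)
Lemma swd_tgt_act u r r' :
  \swd_(u1, u2 <- comul B u) (T (act Y u2 r') * pure r u1) = pure r u * T r'.
Proof.
have fB : balR (fun n w => pure (r * n) w).
  by balance; move=> n a w; rewrite cractE mulrA pure_tgt_unit.
under eq_swd do rewrite smash_tgt_pure.
by rewrite -(swd_yd fB) /T mulr_swdr; apply: eq_swd => r0 r1; rewrite pureM.
Qed.

(** On [r' (x) u], [swd_tgt_act] moves [T r] from the right of the first leg to the left, as
    [T (u2 r)]. Coassociativity pairs this [u2] with the second leg, and crossing the tensor sign
    there gives [u2 r (x) u3 = (1 (x) u2) S r] in Sweedler notation. *)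
Lemma smash_takeuchi (x : H) r :
  \swd_(x1, x2 <- smash_comul x) tensH (x1 * T r) x2
  = \swd_(x1, x2 <- smash_comul x) tensH x1 (x2 * S r).
Proof.
have B1 : balH (fun x1 x2 => tensH (x1 * T r) x2).
  by balance; move=> y a z; rewrite /smash_ract -mulrA tens_smash.
have B2 : balH (fun x1 x2 => tensH x1 (x2 * S r)).
  by balance; move=> y a z; rewrite /smash_ract tens_smash mulrA.
move: x; apply: (pure_ext (g := fun x => \swd_(x1, x2 <- smash_comul x)
    tensH (x1 * T r) x2) (h := fun x => \swd_(x1, x2 <- smash_comul x)
    tensH x1 (x2 * S r))); [by lin | by lin | move=> r' u].
rewrite (swd_smash_comul _ _ B1) (swd_smash_comul _ _ B2).
under eq_swd do rewrite -swd_tgt_act tens_swdl.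
under [RHS]eq_swd do rewrite pure_src tens_swdr.
rewrite (swd_comulA (T := fun a b c => tensH (T (act Y b r) * pure r' a) (pure 1 c))).
- by apply: eq_swd => u1 u2; apply: eq_swd => v1 v2; rewrite [RHS]tens_pure mul1r.
- move=> w; balance; move=> a c b; rewrite /ract /lact pure_tgtl mulrA.
  by rewrite -smash_tgtM -act_src actM.
- move=> w; balance; move=> a c b; rewrite /ract /lact actM act_tgt smash_tgtM.
  by rewrite -mulrA tens_smash pure_srcl.
Qed.

Lemma smash_comulM (x y : H) : smash_comul (x * y) =
  \swd_(y1, y2 <- smash_comul y) \swd_(x1, x2 <- smash_comul x)
    tensH (x1 * y1) (x2 * y2).
Proof.
have B1 (y1 y2 : H) : balH (fun x1 x2 => tensH (x1 * y1) (x2 * y2)).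
  by balance; move=> p a q; rewrite /smash_ract /smash_lact -!mulrA tens_smash.
(* The Takeuchi condition with further right factors [p] and [q] is what makes the inner sum over
   the coproduct of [x'] balanced in the legs of [y]. *)
have tak x' (p q : H) r : \swd_(x1, x2 <- smash_comul x') tensH (x1 * (T r * p)) (x2 * q)
    = \swd_(x1, x2 <- smash_comul x') tensH (x1 * p) (x2 * (S r * q)).
  under eq_swd do rewrite mulrA.
  under [RHS]eq_swd do rewrite mulrA.
  exact: (swd_tens_congr (B1 p q) (smash_takeuchi x' r)).
have B2 x' : balH (fun y1 y2 => \swd_(x1, x2 <- smash_comul x')
    tensH (x1 * y1) (x2 * y2)).
  by balance; move=> p a q; apply: tak.
move: x; apply: (pure_ext (g := fun x => smash_comul (x * y))
  (h := fun x => \swd_(y1, y2 <- smash_comul y) \swd_(x1, x2 <- smash_comul x)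
    tensH (x1 * y1) (x2 * y2))); [by lin | by lin | move=> r u].
move: y; apply: (pure_ext (g := fun y => smash_comul (_ * y))
  (h := fun y => \swd_(y1, y2 <- smash_comul y) \swd_(x1, x2 <- smash_comul _)
    tensH (x1 * y1) (x2 * y2))); [by lin | by lin | move=> r' u'].
rewrite pureM (linear_swdE _ _ smash_comul_linear) (swd_smash_comul _ _ (B2 _)).
under eq_swd do rewrite smash_comul_pure (swd_comulM (balU_pure tB _)).
under [RHS]eq_swd do rewrite (swd_smash_comul _ _ (B1 _ _)).
rewrite exchange_swd; apply: eq_swd => v1 v2.
under [RHS]eq_swd do rewrite pureM tens_swdl pure_mulr.
rewrite (swd_comulA (T := fun a b c =>
  tensH (pure (r * act Y a r') (b * v1)) (pure 1 (c * v2)))) // => w.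
  apply: (balanced_comp (h := fun z => tensH z _)).
    exact: (balanced_linl tB).
  exact: (balU_act (pure_balanced Y)).
exact: (bal_mulr (balU_pure tB _)).
Qed.

(** Apply [x1 (x) x2 |-> counit x1 * counit x2] to the Takeuchi condition; absorbing one counit into
    the other leg and using the two counit axioms restores [x] on each side. *)
Lemma smash_counit_tgtr (x : H) r :
  smash_counit (x * T r) = smash_counit (x * S r).
Proof.
have fB : balH (fun x1 x2 => smash_counit x1 * smash_counit x2).
  by balance; move=> p a q; rewrite smash_counit_ract smash_counit_lact mulrA.
have := swd_tens_congr fB (smash_takeuchi x r).
under eq_swd do rewrite -smash_counit_ract /smash_ract mulrA.
under [X in _ = X -> _]eq_swd do rewrite -smash_counit_lact /smash_lact mulrA.
rewrite -!(linear_swdE _ _ smash_counit_linear) -!mulr_swdl.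
by have := smash_counitl x; have := smash_counitr x; rewrite /smash_lact /smash_ract => -> ->.
Qed.

(** On pure tensors the left side contains [counit (u2 * s (counit u'))] and the right side the
    action of [u1 * t (counit u')] on [r']; the Takeuchi condition of [U] equates them. *)
Lemma smash_counitM_src (x y : H) :
  smash_counit (x * y) = smash_counit (x * S (smash_counit y)).
Proof.
move: x; apply: (pure_ext (g := fun x => smash_counit (x * y))
  (h := fun x => smash_counit (x * S (smash_counit y)))); [by lin | by lin | move=> r u].
move: y; apply: (pure_ext (g := fun y => smash_counit (_ * y))
  (h := fun y => smash_counit (_ * S (smash_counit y)))); [by lin | by lin | move=> r' u'].
rewrite smash_counit_pure pure_src pureM !(linear_swdE _ _ smash_counit_linear).
have fB : balU (fun u1 u2 => r * act Y u1 r' * tunit (counit B u2)).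
  balance; move=> u1 a u2; rewrite /ract /lact actM act_tgt counit_srcl.
  by rewrite tgt_unitM !mulrA.
under eq_swd do rewrite smash_counit_pure counitM_src.
under [RHS]eq_swd do rewrite smash_counit_pure -[r' * _]act_tgt -actM.
exact/esym/(swd_takeuchi fB).
Qed.

Lemma smash_counitM_tgt (x y : H) :
  smash_counit (x * y) = smash_counit (x * T (smash_counit y)).
Proof. by rewrite smash_counit_tgtr smash_counitM_src. Qed.

Definition smash_bialgebroid : left_bialgebroid R H :=
  @LeftBialgebroid k R H S T smash_src_linear smash_src1 smash_srcM
    smash_tgt_linear smash_tgt1 smash_tgtM smash_src_tgtC
    smash_comul smash_counit smash_comul_linear smash_comul_lact smash_comul_ract
    smash_counit_linear smash_counit_lact smash_counit_ract smash_comulA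
    smash_counitl smash_counitr smash_takeuchi smash_comul1 smash_comulM
    smash_counit1 smash_counitM_src smash_counitM_tgt.

Lemma smash_bialgebroidP : is_smash_product smash_bialgebroid.
Proof.
split=> //.
- exact: pureM.
- exact: smash_comul_pure.
- by move=> r u; rewrite cractE; apply: smash_counit_pure.
Qed.

End SmashBialgebroid.

(** * The right Hopf property *)

Section AlphaR.
Variables (k : comPzRingType) (A U : pzAlgType k) (B : left_bialgebroid A U).
Local Notation s := (src B).
Local Notation balU := (balanced (ract B) (lact B)).
Local Notation balB := (balanced (black_ract B) (lact B)).
Local Notation tensB := (tens (black_ract B) (lact B)).

Lemma tensU_tgt u v a : tensU B (tgt B a * u) v = tensU B u (s a * v).
Proof. exact: (tens_act (ract B) (lact B) u a v). Qed.

(** Well-definedness of [alpha_r] rests on [comul (u * s a) = u1 * s a (x) u2]. *)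
Lemma alpha_r_balanced :
  balB (fun u v => \swd_(u1, u2 <- comul B u) tensU B (u1 * v) u2).
Proof.
have fB v : balU (fun u1 u2 => tensU B (u1 * v) u2).
  by balance; move=> u1 a u2; rewrite /ract -mulrA tensU_tgt.
balance; first exact: fB.
move=> u a v; rewrite /black_ract (swd_comul_srcr (fB v)).
by apply: eq_swd => u1 u2; rewrite /lact mulrA.
Qed.

Lemma alpha_r_tens u v : alpha_r (tensB u v)
  = \swd_(u1, u2 <- comul B u) tensU B (u1 * v) u2.
Proof. exact: (tensor_sum_tens alpha_r_balanced). Qed.

Lemma alpha_r_linear : linear (@alpha_r k A U B).
Proof. exact: (tensor_sum_linear alpha_r_balanced). Qed.

Lemma black_srcl_balanced a : balB (fun u v => tensB (s a * u) v).
Proof.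
balance; move=> u b v; rewrite /black_ract mulrA; exact: tens_act.
Qed.

Lemma srcl_balanced a : balU (fun u v => tensU B (s a * u) v).
Proof.
by balance; move=> u b v; rewrite /ract mulrA src_tgtC -mulrA tensU_tgt.
Qed.

(** Left [A]-linearity of [alpha_r]; through its inverse it makes the extension to [R # U] well
    defined over [A]. *)
Lemma alpha_r_srcl a (w : tensor (black_ract B) (lact B)) :
  alpha_r (\swd_(p, q <- w) tensB (s a * p) q)
  = \swd_(p, q <- alpha_r w) tensU B (s a * p) q.
Proof.
move: w; apply: (tensor_ext
  (g := fun w => alpha_r (\swd_(p, q <- w) tensB (s a * p) q))
  (h := fun w => \swd_(p, q <- alpha_r w) tensU B (s a * p) q)) => [||u v].
- apply: (linear_compfun alpha_r_linear); lin; exact: black_srcl_balanced.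
- apply: linear_swd_arg; [exact: srcl_balanced | exact: alpha_r_linear].
rewrite (tensor_sum_tens (black_srcl_balanced a)) !alpha_r_tens.
rewrite (swd_swd _ _ (srcl_balanced a)).
rewrite (swd_comul_srcl (f := fun u1 u2 => tensU B (u1 * v) u2)); last first.
  by balance; move=> u1 b u2; rewrite /ract -mulrA tensU_tgt.
apply: eq_swd => u1 u2.
by rewrite [RHS](tensor_sum_tens (srcl_balanced a)) mulrA.
Qed.

Section Inverse.
Variable beta : tensor (ract B) (lact B) -> tensor (black_ract B) (lact B).
Hypotheses (betaK : cancel beta (@alpha_r k A U B))
           (alphaK : cancel (@alpha_r k A U B) beta).

(** [right_hopf] provides a bare inverse function; its linearity follows from that of the injective
    map [alpha_r]. *)
Lemma inverse_linear : linear beta.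
Proof.
move=> c x y; apply: (can_inj alphaK).
by rewrite alpha_r_linear !betaK.
Qed.

Lemma inverse_srcl a u v :
  beta (tensU B (s a * u) v) = \swd_(p, q <- beta (tensU B u v)) tensB (s a * p) q.
Proof.
apply: (can_inj alphaK).
by rewrite alpha_r_srcl !betaK (tensor_sum_tens (srcl_balanced a)).
Qed.
End Inverse.
End AlphaR.

(** * Comparison of [alpha_r] for [U] and for [R # U] *)

Section SmashHopf.
Variables (k : comPzRingType) (A U : pzAlgType k) (B : left_bialgebroid A U).
Variables (R : pzAlgType k) (Y : yd_algebra B R).
Hypothesis hY : braided_commutative Y.
Local Notation s := (src B).
Local Notation t := (tgt B).
Local Notation balU := (balanced (ract B) (lact B)).
Local Notation balB := (balanced (black_ract B) (lact B)).
Local Notation balR := (balanced (cract Y) (lact B)).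
Local Notation H := (smashA Y).
Local Notation HB := (smash_bialgebroid hY).
Local Notation tunit := (tgt_unit Y).
Local Notation pure := (@smash_tens k A U B R Y).
Local Notation S := (@smash_src k A U B R Y).
Local Notation T := (@smash_tgt k A U B R Y).
Local Notation tensB := (tens (black_ract B) (lact B)).
Local Notation tensHB := (tens (black_ract HB) (lact HB)).

Ltac lin_ext ::= first [lin_smash | lazymatch goal with
  | |- GRing.linear_for _ (fun x => smash_src _ _) =>
      apply: (linear_compfun (smash_src_linear _)); lin
  | |- GRing.linear_for _ (fun x => smash_tgt _ _) =>
      apply: (linear_compfun (smash_tgt_linear _)); lin
  end].

Lemma tensHB_src (x y : H) r : tensHB (x * S r) y = tensHB x (S r * y).
Proof. exact: (tens_act (black_ract HB) (lact HB) x r y). Qed.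

Lemma balB_pure r : balB (fun p q => tensHB (pure r p) (pure 1 q)).
Proof.
balance; move=> p a q; rewrite /black_ract /lact pure_srcl -tensHB_src.
by rewrite -(mulr1 (s a)) -pure_mulr pure_srcl mulr1.
Qed.

Lemma balU_pureU r : balU (fun p q => tensU HB (pure r p) (pure 1 q)).
Proof. exact: (balU_pure hY (tens_balanced (ract HB) (lact HB))). Qed.

(** The component at [r] of the comparison map from [R (x)_A (U (x)_A U)] to the source of [alpha_r]
    for [R # U]; [lift_tgt] is its analogue for the target. *)
Definition lift_src r (w : tensor (black_ract B) (lact B)) :
    tensor (black_ract HB) (lact HB) :=
  \swd_(p, q <- w) tensHB (pure r p) (pure 1 q).

Definition lift_tgt r (w : tensor (ract B) (lact B)) :
    tensor (ract HB) (lact HB) :=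
  \swd_(p, q <- w) tensU HB (pure r p) (pure 1 q).

Lemma lift_src_linear r : linear (lift_src r).
Proof. exact: (tensor_sum_linear (balB_pure r)). Qed.

Lemma lift_src_linearl w : linear (lift_src^~ w).
Proof. by rewrite /lift_src; lin. Qed.

Lemma lift_tgt_linear r : linear (lift_tgt r).
Proof. exact: (tensor_sum_linear (balU_pureU r)). Qed.

(** The coproduct of [r (x) u] is [(r (x) u1) (x) (1 (x) u2)], and right multiplication by [1 (x) v]
    acts only in [U], so [alpha_r] of [R # U] is that of [U] with [r] carried along. *)
Lemma alpha_lift r w : alpha_r (lift_src r w) = lift_tgt r (alpha_r w).
Proof.
move: w; apply: (tensor_ext (g := fun w => alpha_r (lift_src r w))
  (h := fun w => lift_tgt r (alpha_r w))) => [||u v].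
- exact: (linear_compfun (alpha_r_linear (B := HB)) (lift_src_linear r)).
- exact: (linear_compfun (lift_tgt_linear r) (alpha_r_linear (B := B))).
rewrite /lift_src (tensor_sum_tens (balB_pure r)) !alpha_r_tens.
rewrite (linear_swdE _ _ (lift_tgt_linear r)).
rewrite [LHS](swd_smash_comul hY (f := fun x1 x2 : H => tensU HB (x1 * pure 1 v) x2)).
  by apply: eq_swd => u1 u2; rewrite pure_mulr [RHS](tensor_sum_tens (balU_pureU r)).
balance; move=> x1 a x2; rewrite /smash_ract -mulrA; exact: (tensU_tgt HB).
Qed.

(** The values of [lift_src] generate: [(r (x) u) (x) (r' (x) u')] equals
    [(r (x) u) S r' (x) (1 (x) u')], the sum of [(r (u1 r') (x) u2) (x) (1 (x) u')]. *)
Lemma lift_src_ext (G : lmodType k) g h : linear g -> linear h ->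
  (forall r w, g (lift_src r w) = h (lift_src r w)) ->
  g =1 h :> (_ -> G).
Proof.
move=> gL hL gh; apply: tensor_ext => // x y; move: x.
apply: (pure_ext (g := fun x => g (tensHB x y)) (h := fun x => h (tensHB x y))).
- by lin.
- by lin.
move=> r u; move: y.
apply: (pure_ext (g := fun y => g (tensHB _ y)) (h := fun y => h (tensHB _ y))).
- by lin.
- by lin.
move=> r' u'; rewrite -[r']mulr1 -smash_src_pure -tensHB_src pure_src tens_swdl.
rewrite !linear_swdE //; apply: eq_swd => u1 u2.
by have := gh (r * act Y u1 r') (tensB u2 u');
  rewrite /lift_src (tensor_sum_tens (balB_pure _)).
Qed.

(** Here [r'] crosses as left multiplication by [T r'], giving the sum of
    [(r r'_0 (x) r'_1 u) (x) (1 (x) u')]; this expansion uses braided commutativity. *)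
Lemma lift_tgt_ext (G : lmodType k) g h : linear g -> linear h ->
  (forall r w, g (lift_tgt r w) = h (lift_tgt r w)) ->
  g =1 h :> (_ -> G).
Proof.
move=> gL hL gh; apply: tensor_ext => // x y; move: x.
apply: (pure_ext (g := fun x => g (tensU HB x y)) (h := fun x => h (tensU HB x y))).
- by lin.
- by lin.
move=> r u; move: y.
apply: (pure_ext (g := fun y => g (tensU HB _ y)) (h := fun y => h (tensU HB _ y))).
- by lin.
- by lin.
move=> r' u'; rewrite -[r']mulr1 -smash_src_pure -(tensU_tgt HB) smash_tgt_pure //.
rewrite /tensU tens_swdl.
rewrite !linear_swdE //; apply: eq_swd => r0 r1.
by have := gh (r * r0) (tensU B (r1 * u) u');
  rewrite /lift_tgt (tensor_sum_tens (balU_pureU _)).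
Qed.

(** * The inverse of [alpha_r] for [R # U] *)

Section Inverse.
Variable beta : tensor (ract B) (lact B) -> tensor (black_ract B) (lact B).
Hypotheses (betaK : cancel beta (@alpha_r k A U B))
           (alphaK : cancel (@alpha_r k A U B) beta).

Let beta_linear := inverse_linear betaK alphaK.

Lemma lift_src_tgt_unit r a w : lift_src (r * tunit a) w =
  lift_src r (\swd_(p, q <- w) tensB (s a * p) q).
Proof.
rewrite (linear_swdE _ _ (lift_src_linear r)); apply: eq_swd => p q.
by rewrite /lift_src (tensor_sum_tens (balB_pure r)) pure_tgt_unit.
Qed.

(** The intended inverse on elements [x (x) (1 (x) v)]. *)
Definition smash_beta1 v (x : H) : tensor (black_ract HB) (lact HB) :=
  \swd_(r, u <- (x : tensor (cract Y) (lact B))) lift_src r (beta (tensU B u v)).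

(** Balancing over [A] is the left [A]-linearity of [beta]. *)
Lemma smash_beta1_balanced v : balR (fun r u => lift_src r (beta (tensU B u v))).
Proof.
split=> [u|r|r a u].
- exact: lift_src_linearl.
- apply: (linear_compfun (lift_src_linear r)).
  by apply: (linear_compfun beta_linear); lin.
- by rewrite cractE lift_src_tgt_unit -(inverse_srcl betaK alphaK).
Qed.

Lemma smash_beta1_pure v r u :
  smash_beta1 v (pure r u) = lift_src r (beta (tensU B u v)).
Proof. exact: (tensor_sum_tens (smash_beta1_balanced v)). Qed.

Lemma smash_beta1_linear v : linear (smash_beta1 v).
Proof. exact: (tensor_sum_linear (smash_beta1_balanced v)). Qed.

Lemma smash_beta1_linearl x : linear (smash_beta1^~ x).
Proof.
apply: linear_swd => r u; apply: (linear_compfun (lift_src_linear r)).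
by apply: (linear_compfun beta_linear); lin.
Qed.

Lemma smash_beta1_srcl a v (x : H) :
  smash_beta1 (s a * v) x = smash_beta1 v (T (tunit a) * x).
Proof.
move: x; apply: (pure_ext (g := fun x => smash_beta1 _ x)
  (h := fun x => smash_beta1 v (T (tunit a) * x))).
- exact: smash_beta1_linear.
- by apply: (linear_compfun (smash_beta1_linear v)); lin.
move=> r u; rewrite -pure_tgtl // !smash_beta1_pure.
by congr (lift_src _ (beta _)); apply/esym/(tens_act (ract B)).
Qed.

(** A general second factor [r (x) v] is [S r * (1 (x) v)]; [S r] crosses to [x] as [T r], which
    reduces to [smash_beta1]. *)
Definition smash_beta2 (x y : H) : tensor (black_ract HB) (lact HB) :=
  \swd_(r, v <- (y : tensor (cract Y) (lact B))) smash_beta1 v (T r * x).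

Lemma smash_beta2_balR x : balR (fun r v => smash_beta1 v (T r * x)).
Proof.
split=> [v|r|r a v].
- by apply: (linear_compfun (smash_beta1_linear v)); lin.
- exact: smash_beta1_linearl.
- by rewrite cractE smash_tgtM // -mulrA -smash_beta1_srcl.
Qed.

Lemma smash_beta2_pure x r v : smash_beta2 x (pure r v) = smash_beta1 v (T r * x).
Proof. exact: (tensor_sum_tens (smash_beta2_balR x)). Qed.

Lemma smash_beta2_linear x : linear (smash_beta2 x).
Proof. exact: (tensor_sum_linear (smash_beta2_balR x)). Qed.

(** The condition over [R] amounts to [T (a * r) = T r * T a]. *)
Lemma smash_beta2_balanced : balanced (ract HB) (lact HB) smash_beta2.
Proof.
split=> [y|x|x a y].
- apply: linear_swd => r v.
  by apply: (linear_compfun (smash_beta1_linear v)); lin.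
- exact: smash_beta2_linear.
move: y; apply: (pure_ext (g := fun y => smash_beta2 _ y)
  (h := fun y => smash_beta2 x (S a * y))).
- exact: smash_beta2_linear.
- by apply: (linear_compfun (smash_beta2_linear x)); lin.
move=> r v; rewrite smash_src_pure !smash_beta2_pure smash_tgtM //.
by rewrite -mulrA.
Qed.

Definition smash_beta (z : tensor (ract HB) (lact HB)) :
    tensor (black_ract HB) (lact HB) :=
  \swd_(x, y <- z) smash_beta2 x y.

Lemma smash_beta_linear : linear smash_beta.
Proof. exact: (tensor_sum_linear smash_beta2_balanced). Qed.

Lemma smash_beta_lift r w : smash_beta (lift_tgt r w) = lift_src r (beta w).
Proof.
move: w; apply: (tensor_ext (g := fun w => smash_beta (lift_tgt r w))
  (h := fun w => lift_src r (beta w))) => [||u v].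
- exact: (linear_compfun smash_beta_linear (lift_tgt_linear r)).
- exact: (linear_compfun (lift_src_linear r) beta_linear).
rewrite /lift_tgt (tensor_sum_tens (balU_pureU r)).
rewrite /smash_beta (tensor_sum_tens smash_beta2_balanced).
by rewrite smash_beta2_pure smash_tgt1 mul1r smash_beta1_pure.
Qed.

Lemma smash_alphaK : cancel (@alpha_r k R H HB) smash_beta.
Proof.
apply: (lift_src_ext (g := fun z => smash_beta (alpha_r z)) (h := id)) => //.
  exact: (linear_compfun smash_beta_linear (alpha_r_linear (B := HB))).
by move=> r w; rewrite alpha_lift smash_beta_lift alphaK.
Qed.

Lemma smash_betaK : cancel smash_beta (@alpha_r k R H HB).
Proof.
apply: (lift_tgt_ext (g := fun z => alpha_r (smash_beta z)) (h := id)) => //.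
  exact: (linear_compfun (alpha_r_linear (B := HB)) smash_beta_linear).
by move=> r w; rewrite smash_beta_lift alpha_lift betaK.
Qed.
End Inverse.

Lemma smash_right_hopf : right_hopf B -> right_hopf HB.
Proof.
case=> beta alphaK betaK; exists (smash_beta beta).
  exact: smash_alphaK.
exact: smash_betaK.
Qed.
End SmashHopf.

Theorem theorem2p1 (k : comPzRingType) (A U : pzAlgType k)
    (B : left_bialgebroid A U) (R : pzAlgType k) (Y : yd_algebra B R)
    (hY : braided_commutative Y) :
  exists (m : alg_on (smash Y)) (S : left_bialgebroid R (PzAlg m)),
    is_smash_product S /\ (right_hopf B -> right_hopf S).
Proof.
exists (smash_alg Y), (smash_bialgebroid hY); split.
  exact: smash_bialgebroidP.
exact: smash_right_hopf.
Qed.
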